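(* For each positive integer $p$ put $N=2^p-1$, $s=\lceil N^{1/3}\rceil$ and $m=N+ps$. Let $\alpha_1,\dots,\alpha_N$ be an enumeration of all nonzero elements of $\mathbb F_{2^p}$, fix a basis of $\mathbb F_{2^p}$ over $\mathbb Z_2$, and let $U$ be the $N\times ps$ matrix over $\mathbb Z_2$ obtained from the $N\times s$ matrix $(\alpha_k^t)_{1\le k\le N,\,1\le t\le s}$ over $\mathbb F_{2^p}$ by replacing each entry with the row of its $p$ coordinates in the fixed basis. Let $$A=\begin{pmatrix} U & I_N\\ I_{ps} & U^T\end{pmatrix}$$ (an $m\times m$ matrix over $\mathbb Z_2$, invertible for all sufficiently large $p$). Then, as $p\to\infty$, the permutation $v\mapsto Av$ of $\mathbb Z_2^m$ has quantum complexity $$QC(A)\ \ge\ 4m-o(m).$$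
   Context: $\mathbb Z_2$ is the field with two elements and $\mathbb F_{2^p}$ is the field with $2^p$ elements, regarded as a $p$-dimensional vector space over $\mathbb Z_2$. The columns of $U$ are indexed by pairs $(t,i)$ with $1\le t\le s$, $1\le i\le p$, and the entry of $U$ in row $k$ and column $(t,i)$ is $\phi_i(\alpha_k^t)$, where $\phi_1,\dots,\phi_p:\mathbb F_{2^p}\to\mathbb Z_2$ are the coordinate maps of the fixed basis. Local logic gate on $\mathbb Z_2^n$: let $\sigma$ be any permutation of the four-element set $\mathbb Z_2^2$ and let $1\le i<j\le n$. The induced permutation $\sigma_{i,j}$ of $\mathbb Z_2^n$ replaces the coordinates $(c_i,c_j)$ of a vector $(c_1,\dots,c_n)$ by the first and second components of $\sigma(c_i,c_j)$ respectively, and leaves all other coordinates unchanged. The permutations $\sigma_{i,j}$ are called local logic gates. The quantum complexity $QC(T)$ of an invertible affine transformation $T$ of $\mathbb Z_2^n$ (for $n\ge2$) is the minimum number of local logic gates whose composition is equal to $T$; note that the gates used need not be linear. The $o(m)$ term refers to $p\to\infty$. *)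

(* Defs.v *)
From HB Require Import structures.
From mathcomp Require Import all_boot all_order all_fingroup all_algebra all_field.
From mathcomp Require Import all_classical all_reals all_analysis.
Import Order.TTheory GRing.Theory Num.Theory numFieldNormedType.Exports.

Set Implicit Arguments.
Unset Strict Implicit.
Unset Printing Implicit Defensive.

Local Open Scope ring_scope.

Section LocalGates.
Variable n : nat.

Definition localGate : Type :=
  ({perm 'F_2 * 'F_2} * {ij : 'I_n * 'I_n | (ij.1 < ij.2)%N})%type.

Definition applyGate (g : localGate) (c : 'cV['F_2]_n) : 'cV['F_2]_n :=
  let: (i, j) := val g.2 in
  let: (a, b) := g.1 (c i 0, c j 0) in
  \col_k (if k == i then a else if k == j then b else c k 0).

(* The head of the list acts first. *)
Definition applyCircuit (gs : seq localGate) (c : 'cV['F_2]_n) : 'cV['F_2]_n :=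
  foldl (fun v g => applyGate g v) c gs.

Definition computableWith (T : 'cV['F_2]_n -> 'cV['F_2]_n) (k : nat) : bool :=
  [exists gs : k.-tuple localGate, [forall c, applyCircuit gs c == T c]].

(* Every invertible affine T is computable when n >= 2; the value 0 given to
   maps that no circuit computes makes a positive lower bound on QC T include
   the existence of a circuit for T. *)
Definition QC (T : 'cV['F_2]_n -> 'cV['F_2]_n) : nat :=
  if pselect (exists k, computableWith T k) is left exT then ex_minn exT else 0%N.

End LocalGates.

Definition numNonzero (p : nat) : nat := (2 ^ p - 1)%N.

(* The ceiling is an int; it is nonnegative, so absz only casts it to nat. *)
Definition numPowers (R : realType) (p : nat) : nat :=
  `|Num.ceil ((numNonzero p)%:R `^ (3%:R^-1) : R)|%N.

Definition dimA (R : realType) (p : nat) : nat :=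
  (numNonzero p + numPowers R p * p)%N.

Section Matrices.
Variables (N s p : nat) (F : fieldExtType 'F_2).
Variables (alpha : 'I_N -> F) (e : p.-tuple F).

(* Row k lists coord e i (alpha k ^+ t), 1 <= t <= s, with the pairs (t, i) in
   lexicographic order; ordinals start at 0, hence the exponent t.+1. *)
Definition matU : 'M['F_2]_(N, s * p) :=
  \matrix_(k < N) mxvec (\matrix_(t < s, i < p) coord e i (alpha k ^+ t.+1)).

(* The block matrix has N + s * p rows and s * p + N columns; the cast only
   makes it syntactically square. *)
Definition matA : 'M['F_2]_(N + s * p) :=
  castmx (erefl, addnC (s * p) N) (block_mx matU 1%:M 1%:M matU^T).

End Matrices.

(* alpha lists every nonzero element of F exactly once. *)
Definition enumeratesNonzero (N : nat) (F : fieldType) (alpha : 'I_N -> F) : Prop :=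
  injective alpha /\ forall x : F, x != 0 <-> exists k, alpha k = x.

(* Main.v *)
(** Every permutation of the four points of Z_2^2 is affine, so a circuit of [q]
    gates for [A] yields an addition chain of [q] additions of linear forms
    containing all the rows of [A]. Read it as a system of [q] checks, each on
    three variables.
    Putting [x = 0] and [w = 0] (only [o(m)] coordinates) forces [z = y], so that
    the variable computing [z_k] may be identified with [y_k] and its check dropped.
    About [q] variables and [q - N] checks are left, and the solutions are governed
    by the [y] with [U^T y = 0], which by Vandermonde have more than [s] nonzero
    entries: there is no nonzero solution of small support.

    A system of [c] ternary checks on [v] variables without small solutions
    satisfies [3 v <= (4 + o(1)) c]. Indeed, deleting repeatedly the variables
    of degree one with their checks keeps [v - c]; once few of them are left, counting
    incidences gives at least about [3 (v - c)] variables of degree two, and these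
    are the edges of a graph on the checks without short cycles, which has at
    most [(1 + o(1)) c] edges. With [v] near [q] and [c = q - N] this is
    [q >= 4 N - o(N)].

    Since [U^T U = 0], [A] is a permutation of [(1 + X2) (1 + X1)], where [X1] adds
    [U x] to [y] and [X2] adds [U^T y] to [x]; so [A] is invertible and computed by
    CNOT and swap gates. *)
Require Import Defs.
From HB Require Import structures.
From mathcomp Require Import all_boot all_order all_fingroup all_algebra all_field.
From mathcomp Require Import all_classical all_reals all_analysis.
From mathcomp Require Import zify.
Import Order.TTheory GRing.Theory Num.Theory numFieldNormedType.Exports.


Import mathcomp.boot.fintype mathcomp.boot.finset.

Local Open Scope ring_scope.
Set Implicit Arguments.
Unset Strict Implicit.
Unset Printing Implicit Defensive.

(** * Arithmetic of the field with two elements *)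

Lemma F2_neq0 (a : 'F_2) : a != 0 -> a = 1.
Proof. by case: a => [[|[|]]] // ? ?; apply/val_inj. Qed.

Lemma F2_addrr (a : 'F_2) : a + a = 0.
Proof. by case: a => [[|[|]]] // ?; apply/val_inj. Qed.

Lemma F2_oppr (a : 'F_2) : - a = a.
Proof. by apply/esym/eqP; rewrite -addr_eq0 F2_addrr. Qed.

Lemma card_sep (T : finType) (A : {set T}) (P : pred T) :
  #|[set v in A | P v]| = (\sum_(v in A) P v)%N.
Proof.
rewrite -sum1_card big_mkcond [RHS]big_mkcond; apply: eq_bigr => v _.
by rewrite inE; case: (v \in A); case: (P v).
Qed.

(** * Sparse systems over the field with two elements *)

Section SparseSystems.
Variables n q : nat.
Implicit Types (x : 'rV['F_2]_n) (V E T : {set 'I_n}) (C B : {set 'I_q}).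

Definition supp x : {set 'I_n} := [set v | x 0 v != 0].

Lemma supp0P x : (supp x == set0) = (x == 0).
Proof.
apply/eqP/eqP => [x0|->]; last by apply/setP => v; rewrite !inE mxE eqxx.
apply/rowP => v; rewrite mxE; apply/eqP; apply: contraFT (in_set0 v) => xv.
by rewrite -x0 inE.
Qed.

Lemma suppD x y : supp (x + y) \subset supp x :|: supp y.
Proof.
apply/subsetP => v; rewrite !inE mxE; case: (x 0 v =P 0) => //= ->.
by rewrite add0r.
Qed.

Lemma supp_delta v : supp (delta_mx 0 v) = [set v].
Proof. by apply/setP => u; rewrite !inE mxE eqxx /=; case: (u == v). Qed.

Lemma card_suppD x y : (#|supp (x + y)| <= #|supp x| + #|supp y|)%N.
Proof. exact: leq_trans (subset_leq_card (suppD x y)) (leq_card_setU _ _). Qed.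

Variable M : 'M['F_2]_(n, q).

(** Rows of [M] are variables and columns are checks: an assignment is a row vector [x], and the
    checks it violates are the nonzero entries of [x *m M]. *)
Definition nbrs C (v : 'I_n) : {set 'I_q} := [set c in C | M v c != 0].

Definition no_small_solution (L : nat) V C :=
  forall x, supp x \subset V ->
    (forall c, c \in C -> (x *m M) 0 c = 0) -> (#|supp x| <= L)%N -> x = 0.

Lemma no_small_solutionS L L' V V' C : (L' <= L)%N -> V' \subset V ->
  no_small_solution L V C -> no_small_solution L' V' C.
Proof.
move=> LL VV ns x xV xC xL; apply: ns => //; first exact: fintype.subset_trans VV.
exact: leq_trans LL.
Qed.

(** A check of [C] lying in [B] has coefficient zero at every variable of [E], so vectors supported
    in [E] satisfy it automatically. *)
Lemma no_small_solution_delete L E C B :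
  (forall v, v \in E -> [disjoint nbrs C v & B]) ->
  no_small_solution L E C -> no_small_solution L E (C :\: B).
Proof.
move=> EB ns x xE xC xL; apply: ns => // c cC.
case: (boolP (c \in B)) => cB; last by apply: xC; rewrite inE cB.
rewrite mxE big1 // => v _; case: (x 0 v =P 0) => [->|/eqP xv]; first by rewrite mul0r.
have vE : v \in E by apply: (subsetP xE); rewrite inE.
have /pred0P/(_ c) := EB v vE; rewrite /= cB andbT inE cC /=.
by move/negbFE/eqP->; rewrite mulr0.
Qed.

(** Otherwise the unit vector at [v] would be a solution of weight one. *)
Lemma nbrs_gt0 L V C v : (0 < L)%N -> no_small_solution L V C ->
  v \in V -> (0 < #|nbrs C v|)%N.
Proof.
move=> L0 ns vV; rewrite lt0n cards_eq0; apply/negP => /eqP nv0.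
have d0 : delta_mx 0 v = 0 :> 'rV['F_2]_n.
  apply: ns; rewrite ?supp_delta ?sub1set ?cards1 // => c cC.
  rewrite -rowE mxE; apply/eqP; apply: contraFT (in_set0 c) => mvc.
  by rewrite -nv0 inE cC.
by have /eqP := d0; rewrite -supp0P supp_delta -cards_eq0 cards1.
Qed.

(* Edges are the variables with two checks, vertices are the checks. *)
Section ShortCycles.
Variables (D R : nat).

Definition incident E C B := [set v in E | ~~ [disjoint nbrs C v & B]].
Definition inside E C B := [set v in E | nbrs C v \subset B].

(* [B] is spanned by a tree [T] of depth at most [i] rooted at [r]. *)
Definition spanned E C (r : 'I_q) i B :=
  exists2 T : {set 'I_n}, T \subset E /\ (#|T| < #|B|)%N &
   forall u, u \in B -> exists x, [/\ supp x \subset T, (#|supp x| <= i)%N &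
     forall c, c \in C -> (x *m M) 0 c = (c == u)%:R + (c == r)%:R].

Lemma two_nbrs C v a b : #|nbrs C v| = 2%N -> a \in nbrs C v -> b \in nbrs C v ->
  a != b -> forall c, c \in C -> M v c = (c == a)%:R + (c == b)%:R.
Proof.
move=> n2 an bn ab c cC.
have nE : nbrs C v = [set a; b].
  apply/eqP; rewrite eq_sym eqEcard subUset !sub1set an bn n2 cards2 ab.
  by [].
have : (c \in nbrs C v) = (c \in [set a; b]) by rewrite nE.
rewrite !inE cC /=; case: (c =P a) => [->|ca].
  by rewrite (negPf ab) addr0 /= => /F2_neq0 ->.
case: (c =P b) => [->|cb] /=; first by rewrite add0r => /F2_neq0 ->.
by rewrite addr0 => /negbFE/eqP.
Qed.

(** For an edge inside [B] but outside [T], the two tree paths from the root to its ends close up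
    with it to a nonzero solution of weight at most [i + i + 1]. Hence every edge inside [B] belongs
    to [T]. *)
Lemma spanned_inside E C r i B : B \subset C ->
  (forall v, v \in E -> #|nbrs C v| = 2%N) ->
  no_small_solution (i + i + 1) E C -> spanned E C r i B ->
  (#|inside E C B| < #|B|)%N.
Proof.
move=> BC E2 ns [T [TE TB] hT]; apply: leq_ltn_trans TB; apply: subset_leq_card.
apply/subsetP => e; rewrite inE => /andP[eE eB]; apply: contraT => eT.
have /eqP/cards2P[a [b [ab nE]]] := E2 e eE.
have [aN bN] : a \in nbrs C e /\ b \in nbrs C e by rewrite nE !inE !eqxx orbT.
have [xa [xaT xai xaC]] := hT a (subsetP eB a aN).
have [xb [xbT xbi xbC]] := hT b (subsetP eB b bN).
have : xa + xb + delta_mx 0 e = 0.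
  apply: ns.
  - apply: fintype.subset_trans (suppD _ _) _; rewrite supp_delta subUset sub1set eE andbT.
    apply: fintype.subset_trans (suppD _ _) _; rewrite subUset.
    by rewrite !(fintype.subset_trans _ TE).
  - move=> c cC; rewrite !mulmxDl !mxE.
    have := xaC c cC; have := xbC c cC; rewrite !mxE => -> ->.
    have := two_nbrs (E2 e eE) aN bN ab cC.
    have : row e M 0 c = M e c by rewrite mxE.
    rewrite rowE mxE => -> ->.
    by rewrite [X in X + _]addrACA F2_addrr addr0 F2_addrr.
  - apply: leq_trans (card_suppD _ _) _; rewrite supp_delta cards1 leq_add2r.
    by apply: leq_trans (card_suppD _ _) _; rewrite leq_add.
move/rowP/(_ e); rewrite !mxE !eqxx /=.
have nT x : supp x \subset T -> x 0 e = 0.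
  move=> xT; apply/eqP; apply: contraR eT => xe; apply: (subsetP xT).
  by rewrite inE.
by rewrite !nT // !add0r => /eqP; rewrite oner_eq0.
Qed.

Definition grow E C B := B :|: \bigcup_(v in incident E C B) nbrs C v.

Lemma grow_sub E C B : B \subset C -> grow E C B \subset C.
Proof.
move=> BC; rewrite subUset BC; apply/bigcupsP => v _.
by apply/subsetP => c; rewrite inE => /andP[].
Qed.

Lemma incident_inside E C B : incident E C B \subset inside E C (grow E C B).
Proof.
apply/subsetP => v vi; rewrite inE; have := vi; rewrite inE => /andP[-> _] /=.
by apply/subsetU/orP; right; apply: bigcup_sup vi.
Qed.

(** Each new check is hung on [B] by one incident edge, so the tree gains no more edges than [B]
    gains checks, and paths lengthen by at most one. *)
Lemma spanned_grow E C r i B :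
  (forall v, v \in E -> #|nbrs C v| = 2%N) ->
  spanned E C r i B -> spanned E C r i.+1 (grow E C B).
Proof.
move=> E2 [T [TE TB] hT].
pose new := grow E C B :\: B.
pose link u e := [&& e \in E, u \in nbrs C e & ~~ [disjoint nbrs C e & B]].
have newP (u : 'I_q) : u \in new -> exists e, link u e.
  rewrite !inE => /andP[/negPf-> /=] /bigcupP[e]; rewrite inE => /andP[eE eB] ue.
  by exists e; apply/and3P; split.
(* The [option] type is used since ['I_n] offers no default element for arguments outside [new]. *)
have [ed edP] : exists ed : 'I_q -> option 'I_n,
    forall u, u \in new -> exists2 e, ed u = Some e & link u e.
  exists (fun u => [pick e | link u e]) => u /newP[e le].
  by case: pickP => [e' ?|/(_ e)]; [exists e' | rewrite le].
pose T' := T :|: [set e in pmap ed (enum new)].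
exists T'.
  split.
    rewrite subUset TE; apply/subsetP => e; rewrite inE mem_pmap => /mapP[u].
    by rewrite mem_enum => /edP[e' -> /and3P[? _ _]] [->].
  apply: leq_ltn_trans (leq_card_setU _ _) _.
  have -> : #|grow E C B| = (#|B| + #|new|)%N.
    by rewrite -[LHS](cardsID B) (setIidPr _) ?subsetUl.
  rewrite -addSn leq_add // cardsE; apply: leq_trans (card_size _) _.
  by rewrite size_pmap cardE count_size.
have TT' : T \subset T' by apply: subsetUl.
move=> u uB; have [ub|ub] := boolP (u \in B).
  have [x [xT xi xC]] := hT u ub; exists x; split => //.
    exact: fintype.subset_trans TT'.
  exact: leqW.
have un : u \in new by rewrite inE ub.
have [e eu /and3P[eE ue /pred0Pn[w /andP[/= we wB]]]] := edP u un.
have [x [xT xi xC]] := hT w wB; exists (x + delta_mx 0 e); split.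
- apply: fintype.subset_trans (suppD _ _) _; rewrite supp_delta subUset sub1set.
  rewrite (fintype.subset_trans xT TT') /= !inE mem_pmap; apply/orP; right.
  by rewrite -eu map_f ?mem_enum.
- by apply: leq_trans (card_suppD _ _) _; rewrite supp_delta cards1 addn1.
move=> c cC; rewrite mulmxDl mxE xC // -rowE mxE.
have uw : u != w by apply: contraNneq ub => ->.
rewrite (two_nbrs (E2 e eE) ue we uw cC).
by rewrite addrC -addrA [X in _ + X]addrA F2_addrr add0r.
Qed.

Lemma spanned1 E C r : spanned E C r 0 [set r].
Proof.
exists set0; first by rewrite sub0set cards0 cards1.
move=> u; rewrite inE => /eqP ->; exists 0; split=> [||c _].
- by apply/subsetP => v; rewrite inE mxE eqxx.
- by rewrite leqn0 cards_eq0 supp0P.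
- by rewrite mul0mx mxE F2_addrr.
Qed.

(** Edges incident to one ball around [r] lie inside the next. If all balls of radius up to [R] grew
    faster than the ratio [(D + 1) / D], the number of inside edges would grow geometrically and
    exceed [n]. *)
Lemma slow_growth E C r : (n * D ^ R < D.+1 ^ R)%N -> r \in C ->
  (forall v, v \in E -> #|nbrs C v| = 2%N) ->
  exists B, [/\ r \in B, B \subset C, exists2 i, (i <= R)%N & spanned E C r i B &
     (D * #|incident E C B| <= D.+1 * #|inside E C B|)%N].
Proof.
move=> hR rC E2; pose B i := iter i (grow E C) [set r].
have BS i : B i.+1 = grow E C (B i) by [].
have spB i : spanned E C r i (B i).
  by elim: i => [|i IH]; [exact: spanned1 | rewrite BS; exact: spanned_grow].
have BC i : B i \subset C.
  by elim: i => [|i IH]; [rewrite sub1set | rewrite BS grow_sub].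
have rB i : r \in B i.
  by elim: i => [|i IH]; [rewrite inE | rewrite BS inE IH].
have [[i ih]|no] := pselect (exists i : 'I_R.+1,
    (D * #|incident E C (B i)| <= D.+1 * #|inside E C (B i)|)%N).
  by exists (B i); split => //; exists i => //; rewrite -ltnS.
have fast i : (i <= R)%N ->
    (D.+1 * #|inside E C (B i)| < D * #|inside E C (B i.+1)|)%N.
  move=> iR; have : ~ (D * #|incident E C (B i)| <= D.+1 * #|inside E C (B i)|)%N.
    by move=> h; apply: no; exists (Ordinal (iR : (i < R.+1)%N)).
  move/negP; rewrite -ltnNge => /leq_trans; apply.
  by rewrite leq_mul2l subset_leq_card ?orbT // BS incident_inside.
have big i : (i <= R)%N -> (D.+1 ^ i <= D ^ i * #|inside E C (B i.+1)|)%N.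
  elim: i => [|i IH] iR.
    rewrite !expn0 mul1n; have := fast 0%N isT; case: #|inside E C (B 1)| => //.
    by rewrite muln0.
  have := IH (ltnW iR); have := fast _ iR.
  rewrite !expnS => /ltnW h1 h2.
  apply: leq_trans (leq_mul (leqnn D.+1) h2) _.
  by rewrite mulnCA (mulnC D (_ ^ _)%N) -mulnA leq_mul2l h1 orbT.
have := big R (leqnn R); rewrite leqNgt => /negP[].
apply: leq_ltn_trans hR; rewrite mulnC leq_mul2r; apply/orP; right.
by apply: leq_trans (max_card _) _; rewrite card_ord.
Qed.

(** Cut out a slowly growing ball [B] with all edges meeting it. Fewer than [#|B|] edges lie inside
    and only slightly more meet [B], so the removed part obeys the bound; the rest follows by
    induction on [#|C|]. *)
Lemma few_edges E C : (n * D ^ R < D.+1 ^ R)%N ->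
  (forall v, v \in E -> #|nbrs C v| = 2%N) ->
  no_small_solution (R + R + 1) E C -> (D * #|E| <= D.+1 * #|C|)%N.
Proof.
move=> hR; have [k] := ubnP #|C|; elim: k E C => // k IH E C Ck E2 ns.
have [C0|[r rC]] := set_0Vmem C.
  suff -> : E = set0 by rewrite cards0 muln0.
  apply/setP => v; rewrite [RHS]inE; apply/negP => /E2/eqP.
  suff -> : nbrs C v = set0 by rewrite cards0.
  by apply/setP => c; rewrite C0 !inE.
have [B [rB BC [i iR spB] slow]] := slow_growth hR rC E2.
have inB : (#|inside E C B| < #|B|)%N.
  apply: spanned_inside spB => //; apply: no_small_solutionS ns => //.
  by rewrite leq_add2r leq_add.
pose E' := E :\: incident E C B.
have E'B v : v \in E' -> [disjoint nbrs C v & B].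
  by rewrite !inE => /andP[+ vE]; rewrite vE negbK.
have nE' v : v \in E' -> nbrs (C :\: B) v = nbrs C v.
  move=> /E'B dB; apply/setP => c; rewrite !inE.
  case: (boolP (c \in B)) => //= cB; apply/esym/negP => h.
  by have /pred0P/(_ c) := dB; rewrite /= cB inE h.
have CB : #|C| = (#|B| + #|C :\: B|)%N by rewrite -(cardsID B C) (setIidPr BC).
have EB : #|E| = (#|incident E C B| + #|E'|)%N.
  rewrite -(cardsID (incident E C B) E) (setIidPr _) //.
  by apply/subsetP => v; rewrite inE => /andP[].
rewrite CB EB !mulnDr leq_add //.
  by apply: leq_trans slow _; rewrite leq_mul2l ltnW // orbT.
apply: IH.
- apply: leq_trans (Ck : (#|C| <= k)%N); rewrite CB -[X in (X < _)%N]add0n.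
  by rewrite ltn_add2r (cardD1 r) rB.
- by move=> v vE'; rewrite nE' // E2 //; move: vE'; rewrite inE => /andP[].
apply: no_small_solution_delete => //.
by apply: no_small_solutionS ns => //; exact: subsetDl.
Qed.
End ShortCycles.

(** * Degree counting and removal of leaves *)

Lemma sum_nbrs V C :
  (\sum_(v in V) #|nbrs C v| = \sum_(c in C) #|[set v in V | (M v c != 0)%R]|)%N.
Proof.
under eq_bigr => v _ do rewrite -sum1_card.
rewrite (exchange_big_dep (mem C)) /=; last by move=> v c _; rewrite inE => /andP[].
apply: eq_bigr => c cC; rewrite -sum1_card; apply: eq_bigl => v.
by rewrite !inE cC.
Qed.

Definition sparse k V C :=
  forall c, c \in C -> (#|[set v in V | (M v c != 0)%R]| <= k)%N.

Lemma sparse_sum k V C : sparse k V C ->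
  (\sum_(v in V) #|nbrs C v| <= k * #|C|)%N.
Proof.
move=> sp; rewrite sum_nbrs mulnC -sum_nat_const; exact: leq_sum.
Qed.

Lemma sparseS k V C V' C' : V' \subset V -> C' \subset C ->
  sparse k V C -> sparse k V' C'.
Proof.
move=> VV CC sp c /(subsetP CC)/sp; apply: leq_trans; apply: subset_leq_card.
by apply/subsetP => v; rewrite !inE => /andP[/(subsetP VV) -> ->].
Qed.

Lemma nbrsS C C' v : C' \subset C -> nbrs C' v \subset nbrs C v.
Proof.
by move=> CC; apply/subsetP => c; rewrite !inE => /andP[/(subsetP CC) -> ->].
Qed.

(* A variable of degree one is determined by the others through its check, so
   deleting both keeps the solution space; the supports grow by a factor of at
   most [K + 1]. *)
Lemma no_small_solution_leaves K L V C : (1 < L)%N ->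
  (forall v, v \in V -> (#|nbrs C v| <= K)%N) ->
  no_small_solution (K.+1 * L) V C ->
  let W := [set v in V | #|nbrs C v| == 1%N] in
  exists C', [/\ C' \subset C, #|C| = (#|W| + #|C'|)%N &
    no_small_solution L (V :\: W) C'].
Proof.
move=> L1 hK ns W.
have KL : (1 < K.+1 * L)%N by rewrite (leq_trans L1) // leq_pmull.
have [W0|[v0 v0W]] := set_0Vmem W.
  exists C; split=> //; first by rewrite W0 cards0.
  apply: no_small_solutionS ns; first by rewrite leq_pmull.
  exact: subsetDl.
have WV v : v \in W -> v \in V by rewrite inE => /andP[].
have [c0 _] : exists c, c \in nbrs C v0.
  by apply/set0Pn; move: v0W; rewrite inE -cards_eq0 => /andP[_ /eqP->].
pose ch v := odflt c0 [pick c in nbrs C v].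
have chP v : v \in W -> nbrs C v = [set ch v].
  rewrite inE => /andP[_ /cards1P[c ec]].
  rewrite ec /ch; case: pickP => [c'|/(_ c)]; last by rewrite ec inE eqxx.
  by rewrite ec inE => /eqP <-.
have chC v : v \in W -> ch v \in C /\ M v (ch v) = 1.
  by move/chP/setP/(_ (ch v)); rewrite !inE eqxx => /andP[-> /F2_neq0].
have chM v c : v \in W -> c \in C -> c != ch v -> M v c = 0.
  move=> vW cC cv; apply/eqP; apply: contraNT cv => mvc.
  by rewrite -in_set1 -chP // inE cC.
(* Two leaves on the same check would form a solution of weight two; this is where [1 < L] is
   needed. *)
have ch_inj : {in W &, injective ch}.
  move=> v w vW wW vw; apply/eqP; apply: contraT => nvw.
  have d0 : delta_mx 0 v + delta_mx 0 w = 0 :> 'rV['F_2]_n.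
    apply: ns.
    - by rewrite (fintype.subset_trans (suppD _ _)) // !supp_delta subUset !sub1set !WV.
    - move=> c cC; rewrite mulmxDl -!rowE !mxE.
      have [->|cv] := eqVneq c (ch v).
        by rewrite (chC v vW).2 vw (chC w wW).2 F2_addrr.
      by rewrite !chM // -?vw // addr0.
    - by apply: leq_trans (card_suppD _ _) _; rewrite !supp_delta !cards1.
  move/rowP/(_ v): d0; rewrite !mxE !eqxx (negPf nvw) addr0.
  by move/eqP; rewrite oner_eq0.
exists (C :\: ch @: W); split; first exact: subsetDl.
  rewrite -(card_in_imset ch_inj) -(cardsID (ch @: W) C) (setIidPr _) //.
  by apply/subsetP => _ /imsetP[v /chC[? _] ->].
move=> x xV xC xL.
(* The leaves are given the values that make their own checks hold, which extends [x] to a solution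
   of the full system. *)
pose y : 'rV['F_2]_n := \row_v (if v \in W then (x *m M) 0 (ch v) else 0).
have yW : supp y \subset W.
  by apply/subsetP => v; rewrite inE mxE; case: ifP => //; rewrite eqxx.
have xy0 : x + y = 0.
  apply: ns.
  - rewrite (fintype.subset_trans (suppD _ _)) // subUset.
    rewrite (fintype.subset_trans xV) ?subsetDl // (fintype.subset_trans yW) //.
    by apply/subsetP.
  - move=> c cC; rewrite mulmxDl mxE.
    have [/imsetP[w wW cw]|cW] := boolP (c \in ch @: W).
      rewrite [X in _ + X]mxE (bigD1 w) //= [y 0 w]mxE wW cw (chC w wW).2 mulr1 big1 ?addr0 ?F2_addrr //.
      move=> v vw; rewrite [y 0 v]mxE; case: ifP => vW; last by rewrite mul0r.
      rewrite chM ?mulr0 //; first exact: (chC w wW).1.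
      by apply: contra_neq vw => e; apply: ch_inj.
    rewrite xC ?inE ?cW // add0r mxE big1 // => v _; rewrite [y 0 v]mxE.
    case: ifP => vW; last by rewrite mul0r.
    by rewrite chM ?mulr0 //; apply: contraNneq cW => ->; apply: imset_f.
  - apply: leq_trans (card_suppD _ _) _; rewrite mulSn leq_add //.
    have yi : {in supp y &, injective ch}.
      by move=> v w /(subsetP yW) vW /(subsetP yW) wW; apply: ch_inj.
    (* The checks of the nonzero leaves are distinct and each touches [supp x], where every variable
       has at most [K] checks. *)
    rewrite -(card_in_imset yi).
    apply: (@leq_trans #|\bigcup_(v in supp x) nbrs C v|).
      apply: subset_leq_card; apply/subsetP => _ /imsetP[w wy ->].
      have wW := subsetP yW w wy.
      have : (x *m M) 0 (ch w) != 0 by move: wy; rewrite inE [y 0 w]mxE wW.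
      apply: contraR => /bigcupP nb; rewrite mxE big1 // => v _.
      apply/eqP; apply: contraT; rewrite mulf_eq0 negb_or => /andP[xv mv].
      by case: nb; exists v; rewrite inE // mv (chC w wW).1.
    apply: (@leq_trans (\sum_(v in supp x) #|nbrs C v|)).
      elim/big_rec2: _ => [|v a b _ ab]; first by rewrite cards0.
      by apply: leq_trans (leq_card_setU _ _) _; rewrite leq_add2l.
    apply: (@leq_trans (#|supp x| * K)); last by rewrite mulnC leq_mul2l xL orbT.
    rewrite -sum_nat_const; apply: leq_sum => v vx; apply: hK.
    by have := subsetP xV v vx; rewrite inE => /andP[].
apply/rowP => v; rewrite mxE; apply/eqP; apply: contraT => xv.
have /(subsetP xV) : v \in supp x by rewrite inE.
rewrite inE => /andP[vW _]; move/rowP/(_ v): xy0; rewrite !mxE (negPf vW) addr0.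
by move/eqP; rewrite (negPf xv).
Qed.

(** * The ratio of variables to checks *)

Section Core.
Variables (D R K eta : nat).
Hypothesis hR : (n * D ^ R < D.+1 ^ R)%N.

(** A variable of degree [d >= 1] satisfies [3 <= d + 2 [d = 1] + [d = 2]]. Summing over [V], the
    degrees contribute at most [3 #|C|], the leaves [2 eta], and the degree-two variables are
    bounded by [few_edges]. *)
Lemma core_few_leaves V C : sparse 3 V C ->
  no_small_solution (R + R + 1) V C ->
  (#|[set v in V | #|nbrs C v| == 1%N]| <= eta)%N ->
  (3 * D * #|V| <= (4 * D + 1) * #|C| + 2 * D * eta)%N.
Proof.
move=> sp ns le.
pose E := [set v in V | #|nbrs C v| == 2%N].
have hE : (D * #|E| <= D.+1 * #|C|)%N.
  apply: few_edges hR _ _ => [v|]; first by rewrite inE => /andP[_ /eqP].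
  by apply: no_small_solutionS ns => //; apply/subsetP => v; rewrite inE => /andP[].
have /= := sparse_sum sp; set W := [set v in V | _] in le *.
have : (3 * #|V| <= \sum_(v in V) #|nbrs C v| + 2 * #|W| + #|E|)%N.
  rewrite mulnC -sum_nat_const.
  rewrite !card_sep.
  rewrite big_distrr -!big_split; apply: leq_sum => v vV /=.
  have := nbrs_gt0 (_ : 0 < R + R + 1)%N ns vV; rewrite addn1 => /(_ isT).
  by case: #|nbrs C v| => [|[|[|]]].
move: hE le; move: #|W| #|E| #|C| #|V| (\sum_(v in V) _)%N => w e c v t hE le h1 h2.
have := leq_mul (leqnn D) h1; have := leq_mul (leqnn D) h2.
have := leq_mul (leqnn D) le.
nia.
Qed.

(** A round of deletion with more than [eta] leaves removes equally many checks, so at most [j]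
    rounds occur, each costing a factor [K + 1] in the support bound. Restoring a leaf and its check
    preserves the conclusion because [3 D <= 4 D + 1]. *)
Lemma core_bounded_degree j V C : (#|C| <= j * eta)%N -> sparse 3 V C ->
  (forall v, v \in V -> (#|nbrs C v| <= K)%N) ->
  no_small_solution (K.+1 ^ j * (R + R + 2)) V C ->
  (3 * D * #|V| <= (4 * D + 1) * #|C| + 2 * D * eta)%N.
Proof.
elim: j V C => [|j IH] V C hC sp hK ns.
  apply: core_few_leaves => //.
    by apply: no_small_solutionS ns; rewrite // expn0 mul1n leq_add2l.
  (* For [j = 0] no checks remain, hence no leaves. *)
  rewrite (_ : [set v in V | _] = set0) ?cards0 //.
  apply/setP => v; rewrite !inE; apply/negbTE/negP => /andP[_ /eqP n1].
  have : nbrs C v \subset C by apply/subsetP => c; rewrite inE => /andP[].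
  by move/subset_leq_card; rewrite n1; move: hC; rewrite mul0n leqn0 => /eqP->.
have [le|gt] := leqP #|[set v in V | #|nbrs C v| == 1%N]| eta.
  apply: core_few_leaves => //; apply: no_small_solutionS ns => //.
  apply: leq_trans (leq_pmull _ _); last by rewrite expn_gt0.
  by rewrite leq_add2l.
have L1 : (1 < K.+1 ^ j * (R + R + 2))%N.
  by rewrite (leq_trans _ (leq_pmull _ _)) ?expn_gt0 // addn2.
rewrite expnS -mulnA in ns.
have [C' [C'C cC' ns']] := no_small_solution_leaves L1 hK ns.
set W := [set v in V | _] in gt cC' ns' *.
have cV : #|V| = (#|W| + #|V :\: W|)%N.
  rewrite -(cardsID W V) (setIidPr _) //.
  by apply/subsetP => v; rewrite inE => /andP[].
have := IH (V :\: W) C' _ _ _ ns'.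
have -> : (#|C'| <= j * eta)%N by rewrite mulSn in hC; lia.
move=> /(_ isT) h; have {}h : (3 * D * #|V :\: W| <= (4 * D + 1) * #|C'| + 2 * D * eta)%N.
  apply: h => [|v]; first by apply: sparseS sp => //; exact: subsetDl.
  rewrite inE => /andP[_ /hK]; apply: leq_trans; exact: subset_leq_card (nbrsS _ _).
move: h; rewrite cV cC'; move: #|W| #|C'| #|V :\: W| => w c v; nia.
Qed.

(** Variables of degree above [K] are set to zero. By incidence counting there are at most
    [3 #|C| / (K + 1)] of them, which accounts for the term [9 D]. *)
Lemma sparse_system_bound j V C : (#|C| <= j * eta)%N -> sparse 3 V C ->
  no_small_solution (K.+1 ^ j * (R + R + 2)) V C ->
  (3 * D * K.+1 * #|V| <=
     ((4 * D + 1) * K.+1 + 9 * D) * #|C| + 2 * D * K.+1 * eta)%N.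
Proof.
move=> hC sp ns; pose H := [set v in V | (K < #|nbrs C v|)%N].
have cV : #|V| = (#|H| + #|V :\: H|)%N.
  rewrite -(cardsID H V) (setIidPr _) //.
  by apply/subsetP => v; rewrite inE => /andP[].
have hH : (K.+1 * #|H| <= 3 * #|C|)%N.
  apply: leq_trans (sparse_sum sp); rewrite mulnC -sum_nat_const.
  rewrite big_mkcond [X in (_ <= X)%N]big_mkcond; apply: leq_sum => v _.
  by rewrite inE; case: (v \in V) => //=; case: ifP.
have : (3 * D * #|V :\: H| <= (4 * D + 1) * #|C| + 2 * D * eta)%N.
  apply: core_bounded_degree hC _ _ _.
  - by apply: sparseS sp => //; exact: subsetDl.
  - by move=> v; rewrite !inE => /andP[+ vV]; rewrite vV -leqNgt.
  - by apply: no_small_solutionS ns => //; exact: subsetDl.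
move=> h; have := leq_mul (leqnn K.+1) h; have := leq_mul (leqnn D) hH.
rewrite cV; move: hH h; move: #|H| #|C| #|V :\: H| => w c v; nia.
Qed.

End Core.
End SparseSystems.

(** * Addition chains *)

Definition chain m (fl : seq 'rV['F_2]_m) : Prop :=
  [/\ (m <= size fl)%N, forall i : 'I_m, fl`_i = delta_mx 0 i &
   forall j, (m <= j < size fl)%N -> exists a b,
     [/\ (a < j)%N, (b < j)%N & fl`_j = fl`_a + fl`_b]].

(** The columns of [U] span a code of length [N]; its dual code has minimum distance greater than
    [s]. *)
Definition dual_distance_gt N r s (U : 'M['F_2]_(N, r)) : Prop :=
  forall y : 'rV['F_2]_N, y *m U = 0 -> (#|supp y| <= s)%N -> y = 0.

Lemma sum_pick (I : finType) (x : I -> 'F_2) w : \sum_v x v * (v == w)%:R = x w.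
Proof.
rewrite (bigD1 w) //= eqxx mulr1 big1 ?addr0 // => v /negPf->.
by rewrite mulr0.
Qed.

Section ChainSystem.
Variables (N r s : nat) (U : 'M['F_2]_(N, r)) (A : 'M['F_2]_(N + r)).
Variables (xi : 'I_r -> 'I_(N + r)) (yi : 'I_N -> 'I_(N + r)).
Hypothesis s_gt0 : (0 < s)%N.
Hypothesis Udist : dual_distance_gt s U.
Hypothesis Aunit : A \in unitmx.
Hypothesis xyP : forall i, (exists l, i = xi l) \/ (exists k, i = yi k).
Hypothesis xi_yi : forall l k, xi l != yi k.
Hypothesis yi_inj : injective yi.
Hypothesis Azx : forall k l, A (lshift r k) (xi l) = U k l.
Hypothesis Azy : forall k k', A (lshift r k) (yi k') = (k == k')%:R.
Hypothesis Awy : forall l k, A (rshift N l) (yi k) = U k l.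

Variable fl : seq 'rV['F_2]_(N + r).
Hypothesis fl_chain : chain fl.
Hypothesis fl_rows : forall i, row i A \in fl.

Let m := (N + r)%N.
Let n := size fl.
Let q := (n - m)%N.

(* The computation is specialised to x = 0 and w = 0, and each variable computing
   z_k is identified with the variable y_k, its defining check being dropped. *)
Lemma chain_system : exists (M : 'M['F_2]_(n, q)) (V : {set 'I_n}) (C : {set 'I_q}),
  [/\ sparse M 3 V C, no_small_solution M s V C,
      (#|C| + N)%N = q & (q <= #|V| + r)%N].
Proof.
have [mn flu fls] := fl_chain.
have mkP (c : 'I_q) : (m + c < n)%N by have := ltn_ord c; rewrite /q; lia.
pose mk c := Ordinal (mkP c).
have fls' (c : 'I_q) : exists ab : 'I_n * 'I_n,
    [/\ (ab.1 < m + c)%N, (ab.2 < m + c)%N & fl`_(m + c) = fl`_ab.1 + fl`_ab.2].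
  have [|a [b [ha hb e]]] := fls (m + c)%N; first by rewrite leq_addr mkP.
  by exists (Ordinal (ltn_trans ha (mkP c)), Ordinal (ltn_trans hb (mkP c))).
have [ab abP] := choice fls'.
pose iv := widen_ord mn.
have rowsP i : exists v : 'I_n, fl`_v = row i A.
  have h := fl_rows i; have hi : (index (row i A) fl < n)%N by rewrite index_mem.
  by exists (Ordinal hi); rewrite nth_index.
have [ou ouP] := choice rowsP.
(* Rows of an invertible matrix are distinct, so distinct outputs sit at distinct entries of the
   chain. *)
have ou_inj : injective ou.
  move=> i j ij; have : row i A = row j A by rewrite -!ouP ij.
  rewrite !rowE => /(can_inj (mulmxK Aunit)) /rowP/(_ i).
  by rewrite !mxE !eqxx /=; case: eqP => // _ /eqP; rewrite oner_eq0.
pose zeta k := ou (lshift r k); pose om l := ou (rshift N l).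
have zeta_inj : injective zeta by move=> k k' /ou_inj/lshift_inj.
have zom k l : zeta k != om l.
  by apply/negP => /eqP/ou_inj/eqP; rewrite eq_lrshift.
have zeta_ge k : (m <= zeta k)%N.
  rewrite leqNgt; apply/negP => zm.
  have := ouP (lshift r k); rewrite -/(zeta k) (flu (Ordinal zm)) => e.
  have ez : Ordinal zm = yi k.
    by move/rowP/(_ (yi k)): e; rewrite !mxE Azy !eqxx /=; case: (yi k =P _) => [->|] // _ /eqP; rewrite eq_sym oner_eq0.
  have d0 : delta_mx 0 k = 0 :> 'rV['F_2]_N.
    apply: Udist; last by rewrite supp_delta cards1.
    rewrite -rowE; apply/rowP => l; rewrite !mxE -Azx.
    by move/rowP/(_ (xi l)): e; rewrite !mxE ez (negPf (xi_yi _ _)) => <-.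
  by move/eqP: d0; rewrite -supp0P supp_delta -cards_eq0 cards1.
have iv_zeta i k : iv i != zeta k.
  by apply/eqP => /(congr1 val) /= e; have := zeta_ge k; rewrite -e leqNgt ltn_ord.
pose g (v : 'I_n) := if [pick k | zeta k == v] is Some k then iv (yi k) else v.
have gz k : g (zeta k) = iv (yi k).
  by rewrite /g; case: pickP => [k' /eqP/zeta_inj->|/(_ k)] //; rewrite eqxx.
have gid v : (forall k, zeta k != v) -> g v = v.
  by move=> zv; rewrite /g; case: pickP => // k; rewrite (negPf (zv k)).
pose drop := zeta @: setT :|: ((fun l => iv (xi l)) @: setT :|: om @: setT).
have zeta_drop k : zeta k \in drop by rewrite inE imset_f.
have x_drop l : iv (xi l) \in drop.
  by rewrite inE; apply/orP; right; rewrite inE; apply/orP; left; apply/imsetP; exists l.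
have om_drop l : om l \in drop.
  by rewrite inE; apply/orP; right; rewrite inE (imset_f om) ?orbT.
pose V := ~: drop.
pose C := [set c : 'I_q | [forall k, zeta k != mk c]].
(* A sum of indicators, so that variables which coincide after the identification [g] cancel modulo
   two. *)
pose M : 'M['F_2]_(n, q) := \matrix_(v, c)
  ((v == g (mk c))%:R + ((v == g (ab c).1)%:R + (v == g (ab c).2)%:R)).
have Mx (x : 'rV_n) c : (x *m M) 0 c = x 0 (g (mk c)) + (x 0 (g (ab c).1) + x 0 (g (ab c).2)).
  rewrite mxE; under eq_bigr => v _ do rewrite mxE !mulrDr.
  by rewrite !big_split /= !sum_pick.
exists M, V, C; split.
- move=> c _; apply: (@leq_trans #|[set g (mk c); g (ab c).1; g (ab c).2]|); last first.
    by rewrite !cardsU !cards1; lia.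
  apply: subset_leq_card; apply/subsetP => v; rewrite !inE mxE => /andP[_].
  by do 3!case: (v == _) => //=; rewrite !addr0 eqxx.
- move=> x xV xC xs.
  have x0 v : v \in drop -> x 0 v = 0.
    move=> vd; apply/eqP; apply: contraT => xv; have /(subsetP xV) : v \in supp x by rewrite inE.
    by rewrite inE vd.
  pose Y : 'cV['F_2]_(N + r) := \col_i x 0 (iv i).
  have Yx l : Y (xi l) 0 = 0.
    by rewrite mxE x0.
  pose y : 'rV['F_2]_N := \row_k x 0 (iv (yi k)).
  (* Since [x = 0], a row of [A] sees only the [y] coordinates. *)
  have AY i (t : 'I_N -> 'F_2) : 
      (forall k, A i (yi k) = t k) -> (row i A *m Y) 0 0 = \sum_k t k * y 0 k.
    move=> ht; rewrite mxE.
    rewrite (bigID (fun i => i \in yi @: setT)) /= [X in _ + X]big1 ?addr0.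
      rewrite (big_imset _ (in2W yi_inj)) /=; apply: eq_big => [k|k _]; first by rewrite inE.
      by rewrite !mxE ht.
    move=> i' iy; case: (xyP i') => [[l ->]|[k ik]]; first by rewrite Yx mulr0.
    by rewrite ik imset_f in iy.
  (* Strong induction along the chain: a solution takes at each entry the value of its linear form
     at [Y]. At [z_k], whose check is missing, this holds because the form reduces to [y_k]. *)
  have val_fl k (v : 'I_n) : (v < k)%N -> x 0 (g v) = (fl`_v *m Y) 0 0.
    elim: k v => // k IH v; rewrite ltnS => vk.
    have [[k' /eqP ek]|nz] := pselect (exists k', zeta k' == v).
      rewrite -ek gz /zeta ouP (AY _ (fun k => (k' == k)%:R)) //.
      rewrite (bigD1 k') //= eqxx mul1r big1 ?addr0 ?mxE // => j jk.
      by rewrite eq_sym (negPf jk) mul0r.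
    have zv k' : zeta k' != v by apply/negP => e; apply: nz; exists k'.
    have [vm|mv] := ltnP v m.
      rewrite gid // (flu (Ordinal vm)) -rowE !mxE; congr (x 0 _).
      exact: val_inj.
    have cq : (v - m < q)%N by rewrite ltn_sub2r // (leq_ltn_trans mv).
    have ev : v = mk (Ordinal cq) by apply: val_inj; rewrite /= subnKC.
    have cC : Ordinal cq \in C by rewrite inE; apply/forallP => k'; rewrite -ev.
    have [ha hb e] := abP (Ordinal cq); have := xC _ cC.
    have mcv : (m + (v - m))%N = v by rewrite subnKC.
    rewrite /= mcv in ha hb e.
    rewrite Mx -ev (IH _ (leq_trans ha vk)) (IH _ (leq_trans hb vk)) e mulmxDl
      [X in _ -> _ = X]mxE => /eqP.
    by rewrite addr_eq0 F2_oppr => /eqP.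
  have {}val_fl v : x 0 (g v) = (fl`_v *m Y) 0 0 by exact: (val_fl v.+1).
  (* The outputs [w] were dropped, so [y *m U = 0]; moreover the support of [y] embeds in that of
     [x]. *)
  have y0 : y = 0.
    apply: Udist.
      apply/rowP => l; have := val_fl (om l); rewrite ouP (AY _ (fun k => U k l)) //.
      rewrite gid; last by move=> k; exact: zom.
      rewrite x0 //.
      move=> e; rewrite [LHS]mxE [RHS]mxE [RHS]e; apply: eq_bigr => k _; exact: mulrC.
    have ivy_inj : injective (fun k => iv (yi k)).
      by move=> k k' /(congr1 val) /= /val_inj/yi_inj.
    apply: leq_trans xs; rewrite -(card_imset _ ivy_inj).
    apply: subset_leq_card; apply/subsetP => _ /imsetP[k yk ->].
    by move: yk; rewrite !inE mxE.
  have Y0 : Y = 0.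
    apply/colP => i; case: (xyP i) => [[l ->]|[k ->]]; first by rewrite Yx mxE.
    by move/rowP/(_ k): y0; rewrite !mxE.
  apply/rowP => v; rewrite mxE.
  have [vd|vd] := boolP (v \in drop); first exact: x0.
  have := val_fl v; rewrite Y0 mulmx0 mxE gid // => k.
  by apply: contraNneq vd => <-.
- have -> : C = ~: [set c : 'I_q | [exists k, zeta k == mk c]].
    by apply/setP => c; rewrite !inE negb_exists.
  have zq k : (zeta k - m < q)%N.
    by rewrite ltn_sub2r // (leq_ltn_trans (zeta_ge k)).
  have mkz k : mk (Ordinal (zq k)) = zeta k.
    by apply: val_inj; rewrite /= subnKC.
  have -> : [set c : 'I_q | [exists k, zeta k == mk c]] = [set Ordinal (zq k) | k in setT].
    apply/setP => c; rewrite inE; apply/existsP/imsetP => [[k /eqP e]|[k _ ->]].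
      by exists k => //; apply: val_inj; rewrite /= e /= addKn.
    by exists k; rewrite mkz.
  rewrite cardsCs setCK card_imset ?cardsT ?card_ord.
    rewrite subnK // -[X in (X <= _)%N]card_ord -[X in (_ <= X)%N]card_ord.
    apply: (leq_card (fun k => Ordinal (zq k))) => k k' /(congr1 mk).
    by rewrite !mkz => /zeta_inj.
  by move=> k k' /(congr1 mk); rewrite !mkz => /zeta_inj.
- have : (#|drop| <= N + (r + r))%N.
    apply: leq_trans (leq_card_setU _ _) _; apply: leq_add.
      by apply: leq_trans (leq_imset_card _ _) _; rewrite cardsT card_ord.
    apply: leq_trans (leq_card_setU _ _) _; apply: leq_add.
      by apply: leq_trans (leq_imset_card _ _) _; rewrite cardsT card_ord.
    by apply: leq_trans (leq_imset_card _ _) _; rewrite cardsT card_ord.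
  have cVd : (#|drop| + #|V|)%N = n by rewrite /V cardsC card_ord.
  by rewrite /q /m; move: cVd; move: #|V| #|drop| => v d; lia.
Qed.

(** The sparse system bound with [#|C| = q - N] and [#|V| >= q - r]. *)
Lemma chain_lower_bound D R K eta j :
  (n * D ^ R < D.+1 ^ R)%N -> (q <= N + j * eta)%N ->
  (K.+1 ^ j * (R + R + 2) <= s)%N ->
  ((4 * D + 1) * K.+1 * N <=
     (D + 1) * K.+1 * q + 9 * D * q + 3 * D * K.+1 * r + 2 * D * K.+1 * eta)%N.
Proof.
move=> hR hj hs; have [M [V [C [sp ns cC cV]]]] := chain_system.
have hC : (#|C| <= j * eta)%N by lia.
have := sparse_system_bound hR hC sp (no_small_solutionS hs (subxx V) ns).
have := leq_mul (leqnn (3 * D * K.+1)) cV.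
move: cC; move: #|C| #|V| => c v <-; nia.
Qed.
End ChainSystem.

(** * Local gates and linear circuits *)

Lemma F2_cases (a : 'F_2) : a = 0 \/ a = 1.
Proof. by have [->|/F2_neq0] := eqVneq a 0; [left | right]. Qed.

Lemma sum_F2 (h : 'F_2 -> 'F_2) : \sum_a h a = h 0 + h 1.
Proof.
rewrite (bigD1 0) //= (bigD1 1) //= big1 ?addr0 // => i.
by have [->|->] := F2_cases i; rewrite ?eqxx ?andbF.
Qed.

(** The sum of the four values of [g] is the coefficient of [a * b] in its polynomial form. *)
Lemma F2_affine (g : 'F_2 -> 'F_2 -> 'F_2) : \sum_a \sum_b g a b = 0 ->
  exists k al be : 'F_2, forall a b, g a b = k + al * a + be * b.
Proof.
rewrite !sum_F2 addrA => s.
exists (g 0 0), (g 1 0 - g 0 0), (g 0 1 - g 0 0) => a b; rewrite !F2_oppr.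
have [->|->] := F2_cases a; have [->|->] := F2_cases b;
  rewrite ?mulr0 ?mulr1 ?addr0 //.
- by rewrite addrC -addrA F2_addrr addr0.
- by rewrite addrC -addrA F2_addrr addr0.
move/eqP: s; rewrite addr_eq0 F2_oppr => /eqP <-.
by rewrite [RHS]addrACA -[g 1 0 + _ + _]addrA F2_addrr addr0 addrAC.
Qed.

(** A permutation of the four points preserves the sum of the values of [pr], so the composite has
    no quadratic term; being nonconstant, it has a nonzero linear part. *)
Lemma perm_affine (f : {perm 'F_2 * 'F_2}) (pr : 'F_2 * 'F_2 -> 'F_2) :
  \sum_t pr t = 0 -> (exists t u, pr t <> pr u) ->
  exists k al be : 'F_2, (al, be) != (0, 0) /\
    forall a b, pr (f (a, b)) = k + al * a + be * b.
Proof.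
move=> s0 [t [u tu]]; have [|k [al [be E]]] := @F2_affine (fun a b => pr (f (a, b))).
  rewrite pair_bigA /= -[RHS]s0 [RHS](reindex_inj (@perm_inj _ f)).
  by apply: eq_bigr => -[].
exists k, al, be; split=> //; apply/eqP => -[al0 be0]; apply: tu.
rewrite -[t](permKV f) -[u](permKV f).
by case: (f^-1%g t) (f^-1%g u) => a b [c d]; rewrite !E al0 be0 !mul0r.
Qed.

Section Circuits.
Variable m : nat.
Implicit Types (gs : seq (localGate m)) (B : 'M['F_2]_m).

Lemma chain_units : chain [seq delta_mx 0 i | i <- enum 'I_m].
Proof.
split=> [|i|j]; first by rewrite size_map size_enum_ord.
  by rewrite (nth_map i) ?size_enum_ord // nth_ord_enum.
by rewrite size_map size_enum_ord ltnNge => /andP[->].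
Qed.

Lemma chain_rcons (fl : seq 'rV['F_2]_m) u v : chain fl -> u \in fl -> v \in fl ->
  chain (rcons fl (u + v)).
Proof.
move=> [h1 h2 h3] uf vf; split=> [|i|j]; first by rewrite size_rcons ltnW.
  by rewrite nth_rcons (leq_trans (ltn_ord i) h1).
rewrite size_rcons ltnS [X in _ && X]leq_eqVlt => /andP[mj /orP[/eqP ->|jf]]; last first.
  have [|a [b [ha hb e]]] := h3 j; first by rewrite mj.
  exists a, b; split => //; rewrite !nth_rcons jf e.
  by rewrite (ltn_trans ha jf) (ltn_trans hb jf).
exists (index u fl), (index v fl); rewrite !index_mem uf vf; split=> //.
by rewrite !nth_rcons ltnn eqxx !index_mem uf vf !nth_index.
Qed.

Lemma applyGate_affine (g : localGate m) : exists B d,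
  [/\ forall c, applyGate g c = B *m c + d,
      forall k, k != (val g.2).1 -> k != (val g.2).2 -> row k B = delta_mx 0 k &
      forall k, k = (val g.2).1 \/ k = (val g.2).2 -> exists al be,
        (al, be) != (0, 0) /\
        row k B = al *: delta_mx 0 (val g.2).1 + be *: delta_mx 0 (val g.2).2].
Proof.
case: g => f [[i j] /= ij].
have [| |k1 [a1 [b1 [n1 E1]]]] := @perm_affine f fst.
- by rewrite -(pair_bigA _ (fun a _ => a)) /= !sum_F2 !F2_addrr ?addr0.
- by exists (0, 0), (1, 0).
have [| |k2 [a2 [b2 [n2 E2]]]] := @perm_affine f snd.
- by rewrite -(pair_bigA _ (fun _ b => b)) /= !sum_F2 !F2_addrr ?addr0.
- by exists (0, 0), (0, 1).
have ji : j != i by apply: contraTneq ij => ->; rewrite ltnn.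
pose B : 'M['F_2]_m := \matrix_k (if k == i then a1 *: delta_mx 0 i + b1 *: delta_mx 0 j
  else if k == j then a2 *: delta_mx 0 i + b2 *: delta_mx 0 j else delta_mx 0 k).
exists B, (\col_k (if k == i then k1 else if k == j then k2 else 0)); split.
- move=> c; rewrite /applyGate /=.
  have -> : f (c i 0, c j 0) = ((f (c i 0, c j 0)).1, (f (c i 0, c j 0)).2) by case: (f _).
  rewrite E1 E2; apply/colP => k; rewrite 3![in RHS]mxE.
  have -> : \sum_l B k l * c l 0 = (row k B *m c) 0 0.
    by rewrite mxE; apply: eq_bigr => l _; rewrite [in RHS]mxE.
  rewrite rowK mxE; case: (k =P i) => _; first by rewrite mulmxDl -!scalemxAl -!rowE !mxE addrC addrA.
  case: (k =P j) => _; first by rewrite mulmxDl -!scalemxAl -!rowE !mxE addrC addrA.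
  by rewrite -rowE !mxE addr0.
- by move=> k /= /negPf ki /negPf kj; rewrite rowK ki kj.
by move=> k /= [->|->]; rewrite rowK ?(negPf ji) eqxx; [exists a1, b1 | exists a2, b2].
Qed.

(** If a gate acts on coordinates with linear parts [u] and [v], the new linear parts are nonzero
    combinations, hence among [u], [v] and [u + v]. One addition per gate therefore suffices. *)
Lemma circuit_chain gs : exists B d fl,
  [/\ forall c, applyCircuit gs c = B *m c + d, chain fl,
      size fl = (m + size gs)%N & forall i, row i B \in fl].
Proof.
elim/last_ind: gs => [|gs g [B [d [fl [E ch sz rows]]]]].
  exists 1%:M, 0, [seq delta_mx 0 i | i <- enum 'I_m]; split.
  - by move=> c; rewrite mul1mx addr0.
  - exact: chain_units.
  - by rewrite size_map size_enum_ord addn0.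
  - by move=> i; rewrite row1 map_f // mem_enum.
have [G [d' [EG G1 G2]]] := applyGate_affine g.
set i := (val g.2).1 in G1 G2; set j := (val g.2).2 in G1 G2.
exists (G *m B), (G *m d + d'), (rcons fl (row i B + row j B)); split.
- by move=> c; rewrite /applyCircuit foldl_rcons -/(applyCircuit gs c) EG E mulmxDr mulmxA addrA.
- exact: chain_rcons.
- by rewrite !size_rcons sz addnS.
move=> k; rewrite mem_rcons inE row_mul.
have comb : k = i \/ k = j -> (row k G *m B == row i B + row j B) || (row k G *m B \in fl).
  move=> /G2[al [be [ne ->]]]; rewrite mulmxDl -!scalemxAl -!rowE.
  have [a|a] := F2_cases al; have [b|b] := F2_cases be; rewrite a b ?scale0r ?scale1r ?add0r ?addr0.
  - by rewrite a b eqxx in ne.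
  - by rewrite rows orbT.
  - by rewrite rows orbT.
  - by rewrite eqxx.
have [ki|ki] := eqVneq k i; first by apply: comb; left.
have [kj|kj] := eqVneq k j; first by apply: comb; right.
by rewrite G1 // -rowE rows orbT.
Qed.

Definition computes gs B := forall c, applyCircuit gs c = B *m c.

Lemma computes_chain gs B : computes gs B -> exists fl,
  [/\ chain fl, size fl = (m + size gs)%N & forall i, row i B \in fl].
Proof.
move=> hB; have [B' [d [fl [E ch sz rows]]]] := circuit_chain gs.
have d0 : d = 0 by have := E 0; rewrite hB !mulmx0 add0r.
exists fl; split=> // i; rewrite (_ : B = B') //.
apply/matrixP => k l; have := E (delta_mx l 0); rewrite hB d0 addr0 -!colE.
by move/colP/(_ k); rewrite !mxE.
Qed.

Definition computable B := exists gs, computes gs B.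

Lemma computable1 : computable 1%:M.
Proof. by exists [::] => c; rewrite mul1mx. Qed.

Lemma computableM B1 B2 : computable B1 -> computable B2 -> computable (B1 *m B2).
Proof.
(* The right factor [B2] acts first, and so does the head of the list. *)
move=> [g1 h1] [g2 h2]; exists (g2 ++ g1) => c.
rewrite /applyCircuit foldl_cat -/(applyCircuit g2 c) -/(applyCircuit g1 _).
by rewrite h1 h2 mulmxA.
Qed.

Definition gate (f : {perm 'F_2 * 'F_2}) (i j : 'I_m) (ij : (i < j)%N) : localGate m :=
  (f, exist (fun ij : 'I_m * 'I_m => (ij.1 < ij.2)%N) (i, j) ij).

Lemma applyGateE f (i j : 'I_m) (ij : (i < j)%N) c :
  applyGate (gate f ij) c = \col_k (if k == i then (f (c i 0, c j 0)).1
     else if k == j then (f (c i 0, c j 0)).2 else c k 0).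
Proof. by rewrite /applyGate /=; case: (f _). Qed.

(** Gates require increasing positions; in the opposite order [f] is conjugated by the exchange of
    the two bits. *)
Lemma computable_gate2 (i j : 'I_m) (f : {perm 'F_2 * 'F_2}) B : i != j ->
  (forall c : 'cV_m, B *m c = \col_k (if k == i then (f (c i 0, c j 0)).1
     else if k == j then (f (c i 0, c j 0)).2 else c k 0)) -> computable B.
Proof.
move=> nij hB; have [ij|ji|/val_inj ij] := ltngtP i j; last by rewrite ij eqxx in nij.
  by exists [:: gate f ij] => c; rewrite hB /= -applyGateE.
pose sw (t : 'F_2 * 'F_2) := (t.2, t.1).
have swK : involutive sw by case.
pose h t := sw (f (sw t)).
have hi : injective h by move=> a b /(can_inj swK)/perm_inj/(can_inj swK).
exists [:: gate (perm hi) ji] => c; rewrite hB /applyCircuit [foldl _ _ _]applyGateE.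
apply/colP => k; rewrite !mxE permE /h /sw /=.
have [->|//] := eqVneq k i; by rewrite (negPf nij).
Qed.

(** This is the CNOT gate with control [j] and target [i]. *)
Lemma computable_transvection (i j : 'I_m) : i != j -> computable (1%:M + delta_mx i j).
Proof.
move=> nij; pose h (t : 'F_2 * 'F_2) := (t.1 + t.2, t.2).
have hi : injective h.
  move=> [a b] [c d] e; have bd : b = d := congr1 snd e.
  by have : a + b = c + d := congr1 fst e; rewrite bd => /addIr ->.
apply: (@computable_gate2 i j (perm hi)) => // c; rewrite !permE /=.
apply/colP => k; rewrite mulmxDl mul1mx !mxE.
rewrite (bigD1 j) //= mxE eqxx andbT big1 ?addr0; last first.
  by move=> l /negPf lj; rewrite mxE lj andbF mul0r.
have [->|ki] := eqVneq k i; first by rewrite mul1r.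
by rewrite mul0r addr0; case: eqP => // ->.
Qed.

Lemma computable_perm (s : 'S_m) : computable (perm_mx s).
Proof.
have [ts -> /allP dts] := prod_tpermP s.
elim: ts dts => [|[i j] ts IH] dts.
  by rewrite big_nil perm_mx1; exact: computable1.
rewrite big_cons perm_mxM; apply: computableM; last first.
  by apply: IH => t tin; apply: dts; rewrite inE tin orbT.
have nij : i != j by apply: (dts (i, j)); rewrite inE eqxx.
pose sw (t : 'F_2 * 'F_2) := (t.2, t.1).
have swK : involutive sw by case.
apply: (@computable_gate2 i j (perm (inv_inj swK))) => // c; rewrite !permE /=.
apply/colP => k; rewrite -row_permE !mxE.
by case: tpermP => [->|->|/eqP/negPf-> /eqP/negPf->] //; rewrite ?eqxx // eq_sym (negPf nij).
Qed.

(* The matrices [1 + N] with [N] supported on [P x ~P] form an elementary abelian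
   group generated by the transvections it contains. *)
Lemma computable_block (P : pred 'I_m) (X : 'M['F_2]_m) :
  (forall i j, X i j != 0 -> P i && ~~ P j) -> computable (1%:M + X).
Proof.
move=> hX; pose good (Y : 'M['F_2]_m) :=
  (forall i j, Y i j != 0 -> P i && ~~ P j) /\ computable (1%:M + Y).
have good0 : good 0.
  by split=> [i j|]; [rewrite mxE eqxx | rewrite addr0; exact: computable1].
have goodD Y Z : good Y -> good Z -> good (Y + Z).
  move=> [hY cY] [hZ cZ]; split=> [i j|].
    rewrite mxE; have [->|/hY //] := eqVneq (Y i j) 0; by rewrite add0r; exact: hZ.
  have YZ : Y *m Z = 0.
    apply/matrixP => i j; rewrite !mxE big1 // => k _.
    apply/eqP; apply: contraT; rewrite mulf_eq0 negb_or => /andP[/hY/andP[_ h] /hZ/andP[]].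
    by rewrite (negPf h).
  have -> : 1%:M + (Y + Z) = (1%:M + Y) *m (1%:M + Z).
    by rewrite mulmxDl !mulmxDr YZ !mul1mx mulmx1 addr0 -addrA [Z + Y]addrC.
  exact: computableM.
suff : good X by case.
rewrite (matrix_sum_delta X); apply: (big_ind good) => // i _.
apply: (big_ind good) => // j _.
have [x0|/[dup] /hX/andP[Pi Pj] /F2_neq0 x1] := eqVneq (X i j) 0.
  by rewrite x0 scale0r.
rewrite x1 scale1r; split=> [k l|].
  by rewrite mxE; have [->|_] := eqVneq k i; have [->|_] := eqVneq l j; rewrite ?Pi ?Pj ?eqxx.
by apply: computable_transvection; apply: contraNneq Pj => <-.
Qed.

End Circuits.

(** Computability rules out the default value 0 of [QC], so the minimum is attained by a circuit. *)
Lemma QC_computes m (B : 'M['F_2]_m) : computable B ->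
  exists2 gs, computes gs B & QC (fun v => B *m v) = size gs.
Proof.
move=> [gs hgs]; rewrite /QC; case: pselect => [exT|[]].
  case: ex_minnP => k /existsP[t /forallP ht] _; exists t; last by rewrite size_tuple.
  by move=> c; apply/eqP.
exists (size gs); apply/existsP; exists (in_tuple gs); apply/forallP => c.
by rewrite /= hgs.
Qed.

(** * The block matrix *)

Section BlockMatrix.
Variables (N r : nat) (U : 'M['F_2]_(N, r)).

(** The shape of [matA] for arbitrary [U]. Columns list [x] before [y], while rows list the [N]
    outputs [z] before the outputs [w]. *)
Definition blockA : 'M['F_2]_(N + r) :=
  castmx (erefl, addnC r N) (block_mx U 1%:M 1%:M U^T).

Definition xidx (l : 'I_r) : 'I_(N + r) := cast_ord (addnC r N) (lshift N l).
Definition yidx (k : 'I_N) : 'I_(N + r) := cast_ord (addnC r N) (rshift r k).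

Lemma xyidxP i : (exists l, i = xidx l) \/ (exists k, i = yidx k).
Proof.
rewrite -[i](cast_ordKV (addnC r N)).
case: (split_ordP (cast_ord (esym (addnC r N)) i)) => j ->.
  by left; exists j.
by right; exists j.
Qed.

Lemma xidx_yidx l k : xidx l != yidx k.
Proof. by rewrite (inj_eq (@cast_ord_inj _ _ _)) eq_lrshift. Qed.

Lemma yidx_inj : injective yidx.
Proof. by move=> k k' /cast_ord_inj/rshift_inj. Qed.

Lemma xidx_inj : injective xidx.
Proof. by move=> k k' /cast_ord_inj/lshift_inj. Qed.

Lemma blockA_zx k l : blockA (lshift r k) (xidx l) = U k l.
Proof. by rewrite castmxE /= cast_ord_id cast_ordK block_mxEul. Qed.

Lemma blockA_zy k k' : blockA (lshift r k) (yidx k') = (k == k')%:R.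
Proof. by rewrite castmxE /= cast_ord_id cast_ordK block_mxEur mxE. Qed.

Lemma blockA_wx l l' : blockA (rshift N l) (xidx l') = (l == l')%:R.
Proof. by rewrite castmxE /= cast_ord_id cast_ordK block_mxEdl mxE. Qed.

Lemma blockA_wy l k : blockA (rshift N l) (yidx k) = U k l.
Proof. by rewrite castmxE /= cast_ord_id cast_ordK block_mxEdr mxE. Qed.

Definition xsel : 'M['F_2]_(r, N + r) := \matrix_(l, j) (j == xidx l)%:R.
Definition ysel : 'M['F_2]_(N, N + r) := \matrix_(k, j) (j == yidx k)%:R.

Lemma mul_sel n1 n2 (f : 'I_n1 -> 'I_(N + r)) (g : 'I_n2 -> 'I_(N + r)) :
  (\matrix_(l, j) (j == f l)%:R : 'M['F_2]_(n1, _)) *m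
  (\matrix_(l, j) (j == g l)%:R : 'M['F_2]_(n2, _))^T =
  \matrix_(l, l') (f l == g l')%:R.
Proof.
apply/matrixP => l l'; rewrite !mxE.
under eq_bigr => j _ do rewrite !mxE mulrC.
exact: sum_pick.
Qed.

Lemma mul_xx : xsel *m xsel^T = 1%:M.
Proof. by rewrite mul_sel; apply/matrixP => i j; rewrite !mxE (inj_eq xidx_inj). Qed.

Lemma mul_xy : xsel *m ysel^T = 0.
Proof. by rewrite mul_sel; apply/matrixP => i j; rewrite !mxE (negPf (xidx_yidx _ _)). Qed.

Lemma mul_yx : ysel *m xsel^T = 0.
Proof. by rewrite -[LHS]trmxK trmx_mul trmxK mul_xy trmx0. Qed.

Lemma mul_yy : ysel *m ysel^T = 1%:M.
Proof. by rewrite mul_sel; apply/matrixP => i j; rewrite !mxE (inj_eq yidx_inj). Qed.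

Lemma blockAE : blockA = col_mx (U *m xsel + ysel) (xsel + U^T *m ysel).
Proof.
have selx n (X : 'M['F_2]_(n, r)) i l : (X *m xsel) i (xidx l) = X i l.
  rewrite mxE; under eq_bigr => j _ do rewrite mxE (inj_eq xidx_inj) eq_sym.
  exact: sum_pick.
have sely n (X : 'M['F_2]_(n, N)) i l : (X *m ysel) i (yidx l) = X i l.
  rewrite mxE; under eq_bigr => j _ do rewrite mxE (inj_eq yidx_inj) eq_sym.
  exact: sum_pick.
have selxy n (X : 'M['F_2]_(n, r)) i l : (X *m xsel) i (yidx l) = 0.
  by rewrite mxE big1 // => j _; rewrite mxE eq_sym (negPf (xidx_yidx _ _)) mulr0.
have selyx n (X : 'M['F_2]_(n, N)) i l : (X *m ysel) i (xidx l) = 0.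
  by rewrite mxE big1 // => j _; rewrite mxE (negPf (xidx_yidx _ _)) mulr0.
apply/matrixP => i j; case: (split_ordP i) => k ->.
  rewrite col_mxEu mxE; case: (xyidxP j) => [[l ->]|[l ->]].
    by rewrite blockA_zx selx mxE (negPf (xidx_yidx _ _)) addr0.
  by rewrite blockA_zy selxy mxE add0r (inj_eq yidx_inj) eq_sym.
rewrite col_mxEd mxE; case: (xyidxP j) => [[l ->]|[l ->]].
  by rewrite blockA_wx selyx mxE addr0 (inj_eq xidx_inj) eq_sym.
by rewrite blockA_wy sely mxE eq_sym (negPf (xidx_yidx _ _)) add0r mxE.
Qed.

(** Output [z_k] takes the place of [y_k] and [w_l] that of [x_l]. *)
Definition out_idx (i : 'I_(N + r)) : 'I_(N + r) :=
  match split i with inl k => yidx k | inr l => xidx l end.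

Lemma out_idx_inj : injective out_idx.
Proof.
move=> i j; rewrite /out_idx.
case: (split_ordP i) => k ->; case: (split_ordP j) => l -> //.
- by move/yidx_inj ->.
- by move/eqP; rewrite eq_sym (negPf (xidx_yidx _ _)).
- by move/eqP; rewrite (negPf (xidx_yidx _ _)).
- by move/xidx_inj ->.
Qed.

Lemma perm_out : perm_mx (perm out_idx_inj) = col_mx ysel xsel :> 'M['F_2]_(N + r).
Proof.
apply/matrixP => i j; rewrite !mxE permE /out_idx.
by case: (split i) => k; rewrite mxE eq_sym.
Qed.

Let X1 := ysel^T *m U *m xsel.
Let X2 := xsel^T *m U^T *m ysel.
Hypothesis UU : U^T *m U = 0.

(** After [1 + X1] the [y] part is [y + U x]; then [X2] adds [U^T y + U^T U x] to [x], and the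
    second term vanishes by [UU]. *)
Lemma blockA_factor :
  blockA = perm_mx (perm out_idx_inj) *m ((1%:M + X2) *m (1%:M + X1)).
Proof.
have X21 : X2 *m X1 = 0.
  by rewrite /X1 /X2 !mulmxA -(mulmxA _ ysel) mul_yy mulmx1 -(mulmxA _ _ U) UU mulmx0 mul0mx.
have -> : (1%:M + X2) *m (1%:M + X1) = 1%:M + X1 + X2.
  by rewrite mulmxDl mul1mx mulmxDr mulmx1 X21 addr0.
rewrite perm_out blockAE mul_col_mx.
rewrite !mulmxDr !mulmx1 /X1 /X2 !mulmxA mul_yy mul_yx mul_xx mul_xy.
by rewrite !mul0mx !mul1mx !addr0 [ysel + _]addrC.
Qed.

Lemma sel_supp n1 n2 (f : 'I_n1 -> 'I_(N + r)) (g : 'I_n2 -> 'I_(N + r)) V i j :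
  ((\matrix_(l, j) (j == f l)%:R)^T *m V *m (\matrix_(l, j) (j == g l)%:R)) i j
    != 0 :> 'F_2 -> (exists k, i = f k) /\ (exists l, j = g l).
Proof.
move=> h; split; apply: contraPP h => no; apply/negP; rewrite negbK; apply/eqP.
  rewrite -mulmxA mxE big1 // => k _; rewrite !mxE.
  by case: eqP => [e|_]; [case: no; exists k | rewrite mul0r].
rewrite mxE big1 // => k _; rewrite [X in _ * X]mxE.
by case: eqP => [e|_]; [case: no; exists k | rewrite mulr0].
Qed.

Lemma computable_blockA : computable blockA.
Proof.
rewrite blockA_factor; apply: computableM; first exact: computable_perm.
apply: computableM.
  apply: (@computable_block _ [pred i | [exists l, i == xidx l]]) => i j.
  move=> /sel_supp[[k ->] [l ->]]; apply/andP; split; first by apply/existsP; exists k.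
  by rewrite negb_exists; apply/forallP => k'; rewrite eq_sym xidx_yidx.
apply: (@computable_block _ [pred i | [exists l, i == yidx l]]) => i j.
move=> /sel_supp[[k ->] [l ->]]; apply/andP; split; first by apply/existsP; exists k.
by rewrite negb_exists; apply/forallP => k'; rewrite xidx_yidx.
Qed.

(** Both [X1] and [X2] square to zero, so [1 + X1] and [1 + X2] are involutions. *)
Lemma blockA_unit : blockA \in unitmx.
Proof.
have inv1 n (X : 'M['F_2]_n) : X *m X = 0 -> 1%:M + X \in unitmx.
  move=> XX; suff /mulmx1_unit[] : (1%:M + X) *m (1%:M + X) = 1%:M by [].
  rewrite mulmxDl mul1mx mulmxDr mulmx1 XX addr0 -addrA.
  suff -> : X + X = 0 by rewrite addr0.
  by apply/matrixP => i j; rewrite !mxE F2_addrr.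
rewrite blockA_factor !unitmx_mul unitmx_perm !inv1 //.
  by rewrite /X1 !mulmxA -(mulmxA _ xsel) mul_xy mulmx0 !mul0mx.
by rewrite /X2 !mulmxA -(mulmxA _ ysel) mul_yx mulmx0 !mul0mx.
Qed.

Lemma QC_blockA_bound s D R K eta j :
  (0 < s)%N -> dual_distance_gt s U ->
  let q := QC (fun v => blockA *m v) in
  ((N + r + q) * D ^ R < D.+1 ^ R)%N -> (q <= N + j * eta)%N ->
  (K.+1 ^ j * (R + R + 2) <= s)%N ->
  ((4 * D + 1) * K.+1 * N <=
     (D + 1) * K.+1 * q + 9 * D * q + 3 * D * K.+1 * r + 2 * D * K.+1 * eta)%N.
Proof.
move=> s0 dU q; rewrite /q; have [gs hgs ->] := QC_computes computable_blockA.
have [fl [ch sz rows]] := computes_chain hgs => hR hj hs.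
have := @chain_lower_bound N r s U blockA xidx yidx s0 dU blockA_unit xyidxP
  xidx_yidx yidx_inj blockA_zx blockA_zy blockA_wy fl ch rows D R K eta j.
by rewrite sz addKn; apply.
Qed.

End BlockMatrix.

(** * The matrix of powers *)

Section PowerMatrix.
Variables (p : nat) (F : fieldExtType 'F_2).
Variables (alpha : 'I_(numNonzero p) -> F) (e : p.-tuple F).
Hypothesis p_gt1 : (1 < p)%N.
Hypothesis alphaP : enumeratesNonzero alpha.
Hypothesis eP : basis_of {:F} e.

Let N := numNonzero p.
Let alpha_inj : injective alpha. Proof. by case: alphaP. Qed.

Let alpha_neq0 k : alpha k != 0.
Proof. by case: alphaP => _ h; apply/h; exists k. Qed.

Let N1 : (2 ^ p)%N = N.+1.
Proof. by rewrite /N /numNonzero subn1 prednK // expn_gt0. Qed.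

Let e_span (x : F) : x = \sum_i coord e i x *: e`_i.
Proof. by apply: coord_basis eP _; exact: memvf. Qed.

Lemma coord_eq0 (x : F) : (forall i, coord e i x = 0) -> x = 0.
Proof. by move=> h; rewrite (e_span x) big1 // => i _; rewrite h scale0r. Qed.

Lemma mul_alpha (g : F) : g != 0 -> exists2 s : 'I_N -> 'I_N, injective s &
  forall k, g * alpha k = alpha (s k).
Proof.
move=> g0; have h k : exists l, g * alpha k = alpha l.
  case: alphaP => _ /(_ (g * alpha k))[h _].
  by have [|l <-] := h; [rewrite mulf_neq0 | exists l].
have [s sP] := choice h; exists s => // k l kl; apply: alpha_inj.
by apply: (mulfI g0); rewrite !sP kl.
Qed.

(** As for Fermat's little theorem: multiplication by [x] permutes the nonzero elements, and their
    product is compared before and after. *)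
Lemma expf_order (x : F) : x ^+ (2 ^ p) = x.
Proof.
rewrite N1; have [->|x0] := eqVneq x 0; first by rewrite exprS mul0r.
have [s s_inj sP] := mul_alpha x0.
suff : x ^+ N = 1 by rewrite exprS => ->; rewrite mulr1.
have P0 : \prod_k alpha k != 0 by apply/prodf_neq0 => k _.
apply: (mulIf P0); rewrite mul1r [RHS](reindex_inj s_inj) /=.
under [RHS]eq_bigr => k _ do rewrite -sP.
by rewrite big_split /= prodr_const card_ord.
Qed.

(* Multiplication by an element that is no n-th root of unity permutes the nonzero
   elements and rescales the sum. *)
Lemma sum_alpha_exp n : (0 < n < N)%N -> \sum_k alpha k ^+ n = 0.
Proof.
move=> /andP[n0 nN].
have [g g0 gn] : exists2 g : F, g != 0 & g ^+ n != 1.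
  have [[k hk]|no] := pselect (exists k, alpha k ^+ n != 1); first by exists (alpha k).
  have P0 : ('X^n - 1 : {poly F}) != 0 by rewrite -size_poly_eq0 size_XnsubC.
  have := @max_poly_roots _ _ [seq alpha k | k <- enum 'I_N] P0.
  rewrite size_XnsubC // size_map size_enum_ord ltnS leqNgt nN map_inj_uniq ?enum_uniq //.
  move=> h; have /h/(_ isT) // : all (root ('X^n - 1)) [seq alpha k | k <- enum 'I_N].
  apply/allP => _ /mapP[k _ ->]; rewrite rootE !hornerE subr_eq0.
  by apply: contraT => hk; case: no; exists k.
have [s s_inj sP] := mul_alpha g0.
apply/eqP; have : g ^+ n * (\sum_k alpha k ^+ n) = \sum_k alpha k ^+ n.
  rewrite [RHS](reindex_inj s_inj) mulr_sumr; apply: eq_bigr => k _.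
  by rewrite -sP exprMn.
by move/eqP; rewrite -subr_eq0 -{2}[\sum_k _]mul1r -mulrBl mulf_eq0 subr_eq0 (negPf gn).
Qed.

Lemma F_pchar2 : 2%N \in [pchar F].
Proof. by rewrite (rmorph_pchar (in_alg F)) // pchar_Fp. Qed.

Lemma sum_exp2 (I : finType) (f : I -> F) c :
  (\sum_i f i) ^+ (2 ^ c) = \sum_i f i ^+ (2 ^ c).
Proof.
elim: c => [|c IH]; first by rewrite expr1; apply: eq_bigr => i _; rewrite expr1.
rewrite expnSr exprM IH -(pFrobenius_autE F_pchar2) rmorph_sum /=.
by apply: eq_bigr => i _; rewrite pFrobenius_autE -exprM.
Qed.

Lemma scale_exp2 (a : 'F_2) (x : F) c : (a *: x) ^+ (2 ^ c) = a *: x ^+ (2 ^ c).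
Proof.
have [->|->] := F2_cases a; last by rewrite !scale1r.
by rewrite !scale0r expr0n expn_eq0.
Qed.

Definition moore : 'M[F]_p := \matrix_(c, j) e`_j ^+ (2 ^ c).

(** A left kernel vector is the coefficient vector of a linearized polynomial of degree at most
    [2 ^ (p - 1)] vanishing on the basis, hence on all of [F]. It has more roots than its degree, so
    it is zero. *)
Lemma moore_unit : moore \in unitmx.
Proof.
rewrite -row_free_unit -kermx_eq0; apply/eqP/row_matrixP => i0; rewrite row0.
set w := row _ _; have wM : w *m moore = 0.
  by apply: sub_kermxP; rewrite row_sub.
pose f : {poly F} := \sum_(c < p) w 0 c *: 'X^(2 ^ c).
have fE x : f.[x] = \sum_c w 0 c * x ^+ (2 ^ c).
  by rewrite horner_sum; apply: eq_bigr => c _; rewrite !hornerE.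
have fx0 x : f.[x] = 0.
  rewrite fE (eq_bigr (fun c : 'I_p => \sum_j w 0 c * (coord e j x *: e`_j) ^+ (2 ^ c))).
    2: by move=> c _; rewrite {1}(e_span x) sum_exp2 mulr_sumr.
  rewrite exchange_big big1 //= => j _.
  under eq_bigr => c _ do rewrite scale_exp2 -scalerAr.
  rewrite -scaler_sumr; have /rowP/(_ j) := wM; rewrite !mxE => h.
  rewrite (_ : \sum_c _ = 0) ?scaler0 // -[RHS]h.
  by apply: eq_bigr => c _; rewrite [moore c j]mxE.
have fsz : (size f <= (2 ^ p.-1).+1)%N.
  apply: leq_trans (size_sum _ _ _) _; apply/bigmax_leqP => c _.
  apply: leq_trans (size_scale_leq _ _) _; rewrite size_polyXn ltnS leq_exp2l //.
  by rewrite -ltnS prednK // ltnW.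
have f0 : f = 0.
  apply/eqP; apply: contraT => fn0.
  have := @max_poly_roots _ f [seq alpha k | k <- enum 'I_N] fn0.
  rewrite size_map size_enum_ord map_inj_uniq ?enum_uniq // => h.
  have /h/(_ isT) : all (root f) [seq alpha k | k <- enum 'I_N].
    by apply/allP => x _; rewrite rootE fx0.
  move/leq_trans => /(_ _ fsz); rewrite ltnS leqNgt => /negP[].
  have : (2 ^ p)%N = (2 * 2 ^ p.-1)%N by rewrite -expnS prednK // ltnW.
  have : (2 ^ 1 <= 2 ^ p.-1)%N by rewrite leq_exp2l // -ltnS prednK // ltnW.
  by rewrite N1; lia.
apply/rowP => c; rewrite [RHS]mxE.
have := congr1 (fun g : {poly F} => g`_(2 ^ c)) f0.
rewrite coef0 coef_sum (bigD1 c) //= coefZ coefXn eqxx mulr1 big1 ?addr0 // => d dc.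
rewrite coefZ coefXn eqn_exp2l // (negPf (_ : (c : nat) != d)) ?mulr0 //.
by rewrite eq_sym.
Qed.

(** Expanding [v k] in the basis turns the hypothesis into [moore *m b = 0]; inverting the Moore
    matrix gives [b = 0], whose coordinates are the claim. *)
Lemma coord_gram_eq0 (u v : 'I_N -> F) :
  (forall c, (c < p)%N -> \sum_k u k * v k ^+ (2 ^ c) = 0) ->
  forall i j, \sum_k coord e i (u k) * coord e j (v k) = 0.
Proof.
move=> huv i j; pose b : 'cV[F]_p := \col_j \sum_k coord e j (v k) *: u k.
have : moore *m b = 0.
  apply/colP => c; rewrite [RHS]mxE -[RHS](huv c) // mxE.
  rewrite [RHS](eq_bigr (fun k => \sum_j u k * (coord e j (v k) *: e`_j) ^+ (2 ^ c))).
    2: by move=> k _; rewrite {1}(e_span (v k)) sum_exp2 mulr_sumr.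
  rewrite exchange_big; apply: eq_bigr => l _ /=.
  rewrite !mxE mulr_sumr; apply: eq_bigr => k _.
  by rewrite scale_exp2 -!scalerAr mulrC.
move/(congr1 (mulmx (invmx moore))); rewrite mulKmx ?moore_unit // mulmx0.
move/colP/(_ j); rewrite !mxE => /(congr1 (coord e i)); rewrite linear0 linear_sum /=.
by move=> h; rewrite -[RHS]h; apply: eq_bigr => k _; rewrite linearZ /= mulrC.
Qed.

(** For [c <= uphalf p] the exponent [t + t' * 2 ^ c] is below [N]. For larger [c], raising the sum
    to the power [2 ^ (p - c)] exchanges the roles of [t] and [t'] and replaces [c] by [p - c]. *)
Lemma sum_alpha_twisted s t t' c : (s * (2 ^ uphalf p).+1 < N)%N ->
  (0 < t <= s)%N -> (0 < t' <= s)%N -> (c < p)%N ->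
  \sum_k alpha k ^+ t * (alpha k ^+ t') ^+ (2 ^ c) = 0.
Proof.
move=> hs /andP[t0 ts] /andP[t0' ts'] cp.
have small a b d : (0 < a <= s)%N -> (0 < b <= s)%N -> (d <= uphalf p)%N ->
    \sum_k alpha k ^+ (a + b * 2 ^ d) = 0.
  move=> /andP[a0 as_] /andP[b0 bs] dp; apply: sum_alpha_exp; rewrite addn_gt0 a0 /=.
  apply: leq_ltn_trans hs; rewrite mulnS leq_add // leq_mul //.
  by rewrite leq_exp2l.
have [le|gt] := leqP c (uphalf p).
  under eq_bigr => k _ do rewrite -exprM -exprD.
  by apply: small; rewrite ?t0 ?t0'.
have cE : (c + (p - c))%N = p by rewrite subnKC // ltnW.
suff : (\sum_k alpha k ^+ t * (alpha k ^+ t') ^+ (2 ^ c)) ^+ (2 ^ (p - c)) = 0.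
  by move/eqP; rewrite expf_eq0 => /andP[_ /eqP].
rewrite sum_exp2 -[RHS](small t' t (p - c)%N) ?t0 ?t0' //.
  apply: eq_bigr => k _; rewrite exprMn -[X in _ * X]exprM -expnD cE expf_order.
  by rewrite -exprM mulrC exprD.
by move: gt; rewrite uphalf_half; have := odd_double_half p; lia.
Qed.

Variable s : nat.
Notation U := (matU s alpha e).

Lemma matUE k t i : U k (mxvec_index t i) = coord e i (alpha k ^+ t.+1).
Proof. by rewrite mxE mxvecE mxE. Qed.

Lemma matU_gram : (s * (2 ^ uphalf p).+1 < N)%N -> U^T *m U = 0.
Proof.
move=> hs; apply/matrixP => a b; rewrite [RHS]mxE mxE.
case/mxvec_indexP: a => t i; case/mxvec_indexP: b => t' j.
under eq_bigr => k _ do rewrite mxE !matUE.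
apply: (@coord_gram_eq0 (fun k => alpha k ^+ t.+1) (fun k => alpha k ^+ t'.+1)) => c cp.
by apply: (sum_alpha_twisted hs _ _ cp); exact: ltn_ord.
Qed.

(* Evaluating a polynomial that vanishes at 0 and at all but one of the points in
   the support of a short kernel vector. *)
Lemma matU_dual_distance : dual_distance_gt s U.
Proof.
move=> y yU ys; apply/eqP; rewrite -supp0P; apply: contraT => /set0Pn[k0 k0y].
have pow t : (t < s)%N -> \sum_k y 0 k *: alpha k ^+ t.+1 = 0.
  move=> ts; apply: coord_eq0 => i.
  have /rowP/(_ (mxvec_index (Ordinal ts) i)) := yU.
  rewrite !mxE linear_sum /= => h; rewrite -[RHS]h; apply: eq_bigr => k _.
  by rewrite linearZ /= matUE.
(* [U] carries only the exponents 1 to [s], hence the condition on the constant coefficient. *)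
have ev (f : {poly F}) : f`_0 = 0 -> (size f <= s.+1)%N -> \sum_k y 0 k *: f.[alpha k] = 0.
  move=> f0 fs; under eq_bigr => k _ do rewrite (horner_coef_wide _ fs) scaler_sumr.
  rewrite exchange_big big1 //= => -[[|t] ts] _ /=.
    by rewrite big1 // => k _; rewrite f0 mul0r scaler0.
  under eq_bigr => k _ do rewrite scalerAr.
  by rewrite -mulr_sumr pow ?mulr0.
pose f : {poly F} := 'X * \prod_(k in supp y :\ k0) ('X - (alpha k)%:P).
have := ev f; rewrite coefXM eqxx => /(_ erefl).
have -> : (size f <= s.+1)%N.
  rewrite /f mulrC size_mulX; last by apply/prodf_neq0 => k _; rewrite polyXsubC_eq0.
  rewrite -big_enum size_prod_XsubC -cardE ltnS.
  by apply: leq_trans ys; rewrite [X in (_ <= X)%N](cardsD1 k0) k0y.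
move=> /(_ isT); rewrite (bigD1 k0) //= big1 ?addr0 => [/eqP|k kk0].
  rewrite scaler_eq0; move: k0y; rewrite inE => /negPf-> /=.
  rewrite hornerM hornerX mulf_eq0 (negPf (alpha_neq0 _)) /= horner_prod.
  move=> /prodf_eq0[k]; rewrite !inE => /andP[kk0 _]; rewrite hornerXsubC subr_eq0.
  by move=> /eqP/alpha_inj e0; rewrite e0 eqxx in kk0.
have [->|yk] := eqVneq (y 0 k) 0; first by rewrite scale0r.
rewrite hornerM horner_prod (bigD1 k) /= ?inE ?kk0 ?yk //.
by rewrite hornerXsubC subrr mul0r mulr0 scaler0.
Qed.

End PowerMatrix.

(** * Asymptotics *)

(** Bernoulli's inequality for [(1 + 1/D) ^ k], cleared of denominators, at [k = D]. *)
Lemma bernoulli2 D : (0 < D)%N -> (2 * D ^ D <= D.+1 ^ D)%N.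
Proof.
move=> D0.
have h k : (D ^ k * (D + k) <= D.+1 ^ k * D)%N.
  elim: k => [|k IH]; first by rewrite !expn0 addn0.
  rewrite !expnS; move: IH; move: (D ^ k)%N (D.+1 ^ k)%N => a b IH; nia.
by have := h D; rewrite addnn -mul2n mulnA leq_pmul2r // mulnC.
Qed.

(** With [w] half the exponent, [p <= 6 (w + 1)] and [6 a <= w + 1], so
    [a p <= (w + 1) ^ 2 <= 4 ^ w]. *)
Lemma linear_leq_exp a p : (36 * a + 4 <= p)%N -> (a * p <= 2 ^ ((p - 1) %/ 3))%N.
Proof.
move=> hp; set v := ((p - 1) %/ 3)%N; have [w hw] : exists w, w = v./2 by exists v./2.
have vE : v = (odd v + w.*2)%N by rewrite hw odd_double_half.
have pw : (p <= 6 * w.+1)%N.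
  have : (p - 1 < 3 * v.+1)%N by rewrite mulnC ltn_ceil.
  by move: vE; case: (odd v); lia.
have aw : (6 * a <= w.+1)%N by lia.
apply: (@leq_trans (w.+1 * w.+1)); first by nia.
apply: (@leq_trans (2 ^ w * 2 ^ w)); first by apply: leq_mul; exact: ltn_expl.
by rewrite -expnD leq_exp2l // vE -addnn leq_addl.
Qed.

Lemma cube_leq a b : (a ^ 3 <= b ^ 3)%N = (a <= b)%N.
Proof. exact: leq_exp2r. Qed.

Section NumPowers.
Variables (R : realType) (p : nat).
Hypothesis p_gt0 : (0 < p)%N.
Let s := numPowers R p.
Let N := numNonzero p.
Let x : R := N%:R `^ 3%:R^-1.

Let x_cube : x ^+ 3 = N%:R.
Proof.
rewrite /x -powR_mulrn ?powR_ge0 // -powRrM mulVf ?pnatr_eq0 //.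
by rewrite powRr1.
Qed.

Let x_ge0 : 0 <= x. Proof. exact: powR_ge0. Qed.

Let sE : s%:R = (Num.ceil x)%:~R :> R.
Proof.
rewrite /s /numPowers -/N -/x natr_absz ger0_norm //.
by rewrite ceil_ge0 (lt_le_trans _ x_ge0) // ltrN10.
Qed.

Lemma numPowers_cube_ge : (N <= s ^ 3)%N.
Proof.
rewrite -(ler_nat R) natrX -x_cube lerXn2r ?nnegrE //.
by rewrite sE ceil_ge.
Qed.

Lemma numPowers_cube_lt : ((s - 1) ^ 3 < N)%N \/ s = 0%N.
Proof.
case: (posnP s) => [->|s0]; [by right | left].
rewrite -(ltr_nat R) natrX -x_cube ltrXn2r ?nnegrE //.
by rewrite natrB // sE; have := ceilB1_lt x; rewrite intrB.
Qed.

(** Here [(p + 2) %/ 3] is the ceiling of [p / 3], and [(s - 1) ^ 3 < N < 2 ^ p] unless [s = 0]. *)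
Lemma numPowers_le : (s <= 2 ^ ((p + 2) %/ 3))%N.
Proof.
case: numPowers_cube_lt => [h|->//]; have : ((s - 1) ^ 3 < (2 ^ ((p + 2) %/ 3)) ^ 3)%N.
  apply: leq_trans h _; rewrite -expnM.
  apply: (@leq_trans (2 ^ p)); first by rewrite /N /numNonzero leq_subr.
  by rewrite leq_exp2l //; have := ltn_ceil (p + 2) (isT : (0 < 3)%N); lia.
by rewrite ltn_exp2r //; lia.
Qed.

Lemma numPowers_ge : (2 ^ ((p - 1) %/ 3) <= s)%N.
Proof.
rewrite -cube_leq; apply: leq_trans numPowers_cube_ge; rewrite -expnM.
apply: (@leq_trans (2 ^ p.-1)).
  by rewrite leq_exp2l // -subn1 leq_divM.
have e : (2 ^ p = 2 * 2 ^ p.-1)%N by rewrite -expnS prednK.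
have : (0 < 2 ^ p.-1)%N by rewrite expn_gt0.
by rewrite /N /numNonzero e; lia.
Qed.
End NumPowers.

Lemma leq_of_linear_bounds D a p : (12 * D <= a -> 36 * a + 4 + 24 <= p -> D <= p)%N.
Proof. lia. Qed.

Lemma double_leq_exponential D p y : (D <= p -> 24 <= p -> p - 2 < y -> 2 * D <= 4 * y - 1)%N.
Proof. lia. Qed.

(** The choice [K + 1 = 9 D] makes [9 D q] a single further [(K + 1) q]. After division by [9 D] the
    excess terms are absorbed in [20 (N + r)], using [q < 4 (N + r)]. *)
Lemma deficit_arith D N r q y : (0 < D -> 2 * D <= N -> 12 * (D * r) <= N ->
  12 * r <= N -> D * y <= N -> q < 4 * (N + r) ->
  (4 * D + 1) * (9 * D) * N <=
    (D + 1) * (9 * D) * q + 9 * D * q + 3 * D * (9 * D) * r + 2 * D * (9 * D) * y.+1 ->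
  4 * D * (N + r) <= D * q + 20 * (N + r))%N.
Proof.
move=> D0 DN Dr rN yN qN h.
have D9 : (0 < 9 * D)%N by rewrite muln_gt0.
have {h} : (9 * D * ((4 * D + 1) * N) <= 9 * D * ((D + 2) * q + 3 * (D * r) + 2 * (D * y) + 2 * D))%N.
  by clear -h; nia.
rewrite leq_pmul2l //; clear -DN Dr rN yN qN; nia.
Qed.

(* For a relative error of order 1/D: degrees are cut off at 9 D, at most 4 D rounds of
   deletions occur as each removes more than N / D checks, and balls have radius at
   most D (p + 4) since (1 + 1/D)^D >= 2. *)
Lemma QC_matA_bound (R : realType) D : (0 < D)%N -> exists P, forall p, (P <= p)%N ->
  forall (F : fieldExtType 'F_2) (alpha : 'I_(numNonzero p) -> F) (e : p.-tuple F),
    enumeratesNonzero alpha -> basis_of {:F} e ->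
    let A := matA (numPowers R p) alpha e in
    A \in unitmx /\
    (4 * D * dimA R p <= D * QC (fun v => A *m v) + 20 * dimA R p)%N.
Proof.
(* The factor [12 D] serves twice: it makes [s p] negligible, and
   [D (p + 4) + D (p + 4) + 2 <= 12 D p]. *)
move=> D0; pose a := (12 * D * (9 * D) ^ (4 * D))%N.
exists (36 * a + 4 + 24)%N => p hp F alpha e alphaP eP A.
have aD : (12 * D <= a)%N by rewrite leq_pmulr // expn_gt0 muln_gt0 D0.
have p24 : (24 <= p)%N by lia.
have p0 : (0 < p)%N by lia.
have pow_p : (2 ^ p = 4 * 2 ^ (p - 2))%N.
  by rewrite -(expnD 2 2) subnKC //; lia.
have pow_p1 : (2 ^ (p - 1) = 2 * 2 ^ (p - 2))%N.
  by rewrite -expnS; congr expn; lia.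
have pow_gt : (p - 2 < 2 ^ (p - 2))%N by exact: ltn_expl.
have sU := numPowers_le R p0; have sL := numPowers_ge R p0.
have lin : (a * p <= 2 ^ ((p - 1) %/ 3))%N by apply: linear_leq_exp; lia.
rewrite /dimA; set s := numPowers R p in A sU sL *; set N := numNonzero p in alpha alphaP A *.
have NE : N = (2 ^ p - 1)%N by [].
have s0 : (0 < s)%N by apply: leq_trans sL; rewrite expn_gt0.
have gram : (s * (2 ^ uphalf p).+1 < N)%N.
  have h1 : (s * (2 ^ uphalf p).+1 <= 2 ^ ((p + 2) %/ 3) * 2 ^ (uphalf p).+1)%N.
    apply: leq_mul => //; rewrite expnS mul2n -addnn -addn1 leq_add2l.
    by rewrite expn_gt0.
  have h2 : (2 ^ ((p + 2) %/ 3) * 2 ^ (uphalf p).+1 <= 2 ^ (p - 2))%N.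
    rewrite -expnD leq_exp2l // uphalf_half.
    by have := odd_double_half p; have := leq_divM (p + 2) 3; case: odd; lia.
  by lia.
have UU := matU_gram (ltnW (leq_trans (isT : (2 < 24)%N) p24)) alphaP eP gram.
have Udist := matU_dual_distance alphaP eP (s := s).
have Aunit : A \in unitmx := blockA_unit UU.
split=> //; set q := QC _.
have Dr : (12 * (D * (s * p)) <= N)%N.
  have h1 : (12 * D * p <= 2 ^ ((p - 1) %/ 3))%N.
    by apply: leq_trans lin; rewrite leq_mul2r aD orbT.
  have h2 : (2 ^ ((p + 2) %/ 3) * 2 ^ ((p - 1) %/ 3) <= 2 ^ (p - 1))%N.
    rewrite -expnD leq_exp2l //.
    by have := leq_divM (p + 2) 3; have := leq_divM (p - 1) 3; lia.
  have h3 := leq_mul sU h1.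
  have : (12 * (D * (s * p)) <= 2 ^ (p - 1))%N.
    by apply: leq_trans h2; apply: leq_trans h3; rewrite [leqRHS]mulnC -!mulnA (mulnC p).
  lia.
(* For [q] at least [4 m] the claim is immediate; otherwise the chain has length below [5 m], which
   is less than [2 ^ (p + 4)]. *)
have [big|small] := leqP (4 * (N + s * p)) q; first by have := leq_mul (leqnn D) big; rewrite !mulnA; lia.
have rN : (12 * (s * p) <= N)%N.
  by apply: leq_trans Dr; rewrite leq_mul2l leq_pmull.
have hR : ((N + s * p + q) * D ^ (D * (p + 4)) < D.+1 ^ (D * (p + 4)))%N.
  rewrite !expnM; have b := bernoulli2 D0.
  apply: (@leq_trans ((2 * D ^ D) ^ (p + 4))); last by rewrite leq_exp2r // addn_gt0 p0.
  rewrite expnMn ltn_pmul2r ?expn_gt0 ?D0 //.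
  by rewrite expnD pow_p; lia.
have hj : (q <= N + 4 * D * (N %/ D).+1)%N.
  have := ltn_ceil N D0; rewrite -[(4 * D * _)%N]mulnA [(D * _)%N]mulnC; move: (_ * D)%N => y; lia.
have hs : ((9 * D).-1.+1 ^ (4 * D) * (D * (p + 4) + D * (p + 4) + 2) <= s)%N.
  rewrite prednK ?muln_gt0 ?D0 //; apply: leq_trans sL; apply: leq_trans lin.
  rewrite /a mulnAC [leqLHS]mulnC leq_mul2r; apply/orP; right.
  have h1 : (D * (p + 4) <= D * (5 * p))%N by rewrite leq_mul2l; apply/orP; right; lia.
  have h2 : (0 < D * p)%N by rewrite muln_gt0 D0.
  move: h1 h2; rewrite mulnCA -mulnA; move: (D * p)%N (D * (p + 4))%N => y z; lia.
have := QC_blockA_bound UU s0 Udist hR hj hs.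
rewrite -/q prednK ?muln_gt0 ?D0 // => h.
have hN : (D * (N %/ D) <= N)%N by rewrite mulnC leq_divM.
have DN : (2 * D <= N)%N.
  have Dp : (D <= p)%N by exact: leq_of_linear_bounds aD hp.
  by rewrite NE pow_p; exact: double_leq_exponential Dp p24 pow_gt.
exact: deficit_arith D0 DN Dr rN hN small h.
Qed.

Local Open Scope classical_set_scope.

Definition deficit_bound (R : realType) (p rho : nat) : Prop :=
  forall (F : fieldExtType 'F_2) (alpha : 'I_(numNonzero p) -> F) (e : p.-tuple F),
    enumeratesNonzero alpha -> basis_of {:F} e ->
    (4 * dimA R p <= QC (fun v => matA (numPowers R p) alpha e *m v) + rho)%N.

Lemma ex_deficit_bound (R : realType) p : exists rho, `[< deficit_bound R p rho >].
Proof. by exists (4 * dimA R p)%N; apply/asboolP => F alpha e _ _; exact: leq_addl. Qed.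

(* The error term may depend neither on the field nor on the enumeration or the basis. *)
Definition min_deficit (R : realType) p : nat := ex_minn (ex_deficit_bound R p).

Lemma min_deficitP (R : realType) p : deficit_bound R p (min_deficit R p).
Proof. by rewrite /min_deficit; case: ex_minnP => m /asboolP. Qed.

Lemma min_deficit_le (R : realType) p rho : deficit_bound R p rho ->
  (min_deficit R p <= rho)%N.
Proof.
by rewrite /min_deficit; case: ex_minnP => m _ h hr; apply: h; apply/asboolP.
Qed.

Theorem mainTheorem5 (R : realType) :
  exists r : nat -> R,
    r =o_\oo (fun p => (dimA R p)%:R : R) /\
    \forall p \near \oo,
      forall (F : fieldExtType 'F_2) (alpha : 'I_(numNonzero p) -> F)
             (e : p.-tuple F),
        \dim {:F} = p -> enumeratesNonzero alpha -> basis_of {:F} e ->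
        let A := matA (numPowers R p) alpha e in
        A \in unitmx /\
        4%:R * (dimA R p)%:R - r p <= (QC (fun v => A *m v))%:R.
Proof.
exists (fun p => (min_deficit R p)%:R); split.
  apply/eqoP => eps eps0.
  (* The relative error [20 / D] is at most [eps]. *)
  pose D := (Num.truncn (20%:R / eps)).+1.
  have [P hP] := @QC_matA_bound R D isT.
  exists P => // p /= Pp; rewrite !ger0_norm ?ler0n //.
  have hD : (min_deficit R p * D <= 20 * dimA R p)%N.
    rewrite -leq_divRL //; apply: min_deficit_le => F alpha e aP eP.
    have [_ h] := hP p Pp F alpha e aP eP.
    move: h; set q := QC _ => h; rewrite -leq_subLR leq_divRL // mulnBl leq_subLR.
    by rewrite mulnAC [(q * D)%N]mulnC.
  have De : 20%:R <= eps * D%:R.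
    rewrite -ler_pdivrMl // mulrC ltW //; exact: truncnS_gt.
  rewrite -(ler_pM2r (_ : 0 < D%:R :> R)) ?ltr0n // -natrM.
  rewrite mulrAC (le_trans (_ : _ <= (20 * dimA R p)%:R)) ?ler_nat //.
  by rewrite natrM ler_wpM2r.
(* Any [D] would do here: only invertibility is taken from this instance. *)
have [P hP] := @QC_matA_bound R 1 isT.
exists P => // p /= Pp F alpha e _ aP eP; split; first by case: (hP p Pp F alpha e aP eP).
by rewrite lerBlDr -natrM -natrD ler_nat; exact: min_deficitP.
Qed.
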